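(* Let $\mathcal{T}$ and $\widetilde{\mathcal{T}}$ be compact nonnegative self-adjoint operators in Hilbert spaces $\mathcal{H}$ and $\widetilde{\mathcal{H}}$ having the spectral asymptotics $$\mathcal{N}(t,\mathcal{T})\sim\frac{\varphi(1/t)\,s(\ln(1/t))}{t^{1/p}},\qquad \mathcal{N}(t,\widetilde{\mathcal{T}})\sim\frac{\widetilde\varphi(1/t)\,\widetilde s(\ln(1/t))}{t^{1/p}},\qquad t\to+0,$$ where $p>0$, $\varphi,\widetilde\varphi$ are slowly varying functions, and $s,\widetilde s$ are continuous periodic functions with periods $T$ and $\widetilde T$, respectively. Suppose that $$\int_1^\infty\varphi(\tau)\frac{d\tau}{\tau}=\int_1^\infty\widetilde\varphi(\tau)\frac{d\tau}{\tau}=\infty,$$ that $s$ and $\widetilde s$ have no common period, i.e. $T$ and $\widetilde T$ are incommensurable, and that for some constant $C$ $$\left|\frac{\sigma\ln(\sigma)\,\varphi'(\sigma)}{\varphi(\sigma)}\right|\le C,\qquad \left|\frac{\sigma\ln(\sigma)\,\widetilde\varphi'(\sigma)}{\widetilde\varphi(\sigma)}\right|\le C,\qquad \sigma\ge1.$$ Then $$\mathcal{N}(t,\mathcal{T}\otimes\widetilde{\mathcal{T}})\sim\frac{\mathfrak{C}\,\phi(1/t)}{t^{1/p}},\qquad t\to+0,$$ where $\phi=\varphi\ast\widetilde\varphi$ and $$\mathfrak{C}=\frac1p\cdot\frac1T\int_0^T s(t)\,dt\cdot\frac1{\widetilde T}\int_0^{\widetilde T}\widetilde s(t)\,dt.$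$
   Context: For a compact nonnegative self-adjoint operator $\mathcal{T}$ in a Hilbert space, $\lambda_n=\lambda_n(\mathcal{T})$ denote its positive eigenvalues arranged in nonincreasing order and repeated according to multiplicity, and $\mathcal{N}(t,\mathcal{T})=\#\{n:\lambda_n(\mathcal{T})>t\}$ for $t>0$. The operator $\mathcal{T}\otimes\widetilde{\mathcal{T}}$ acts in the Hilbert space $\mathcal{H}\otimes\widetilde{\mathcal{H}}$. The relation $f\sim g$ means $f=g\,(1+o(1))$. A positive (measurable) function $\varphi(\tau)$, $\tau>0$, is called slowly varying if $\varphi(c\tau)/\varphi(\tau)\to1$ as $\tau\to+\infty$ for every constant $c>0$. The Mellin convolution is $(\varphi\ast\psi)(\tau)=\int_1^\tau\varphi(\sigma)\psi(\tau/\sigma)\frac{d\sigma}{\sigma}$. Incommensurable means $T/\widetilde T$ is irrational. Standing assumptions: slowly varying functions in the spectral asymptotics are $C^2$-smooth with $\tau(\ln\varphi)'(\tau)\to0$ and $\tau^2(\ln\varphi)''(\tau)\to0$ as $\tau\to\infty$; the periodic functions $s,\widetilde s$ are continuous, positive (bounded and separated from zero), and $s(\tau)=e^{-\tau/p}\varrho(\tau)$, $\widetilde s(\tau)=e^{-\tau/p}\widetilde\varrho(\tau)$ with $\varrho,\widetilde\varrho$ monotone. *)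

(* Defs.v *)
From HB Require Import structures.
From mathcomp Require Import all_boot all_order all_algebra.
From mathcomp Require Import sesquilinear complex finmap.
From mathcomp Require Import all_classical all_reals all_analysis.
Set Implicit Arguments.
Unset Strict Implicit.
Unset Printing Implicit Defensive.
Import Order.TTheory GRing.Theory Num.Theory.
Import numFieldNormedType.Exports.
Local Open Scope ring_scope.
Local Open Scope classical_set_scope.

(* Real and complex Hilbert spaces are treated uniformly. *)
Variant scalar_kind := RealScalars | ComplexScalars.

Definition scalar_field (R : realType) (k : scalar_kind) : numFieldType :=
  match k with
  | RealScalars => R : numFieldType
  | ComplexScalars => R[i] : numFieldType
  end.

Definition conj_scalar (R : realType) (k : scalar_kind) :
    scalar_field R k -> scalar_field R k :=
  match k with
  | RealScalars => idfun
  | ComplexScalars => @Num.conj R[i]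
  end.

Definition of_real (R : realType) (k : scalar_kind) : R -> scalar_field R k :=
  match k with
  | RealScalars => idfun
  | ComplexScalars => real_complex R
  end.

(* The inner product is linear in its first argument. *)
Record hilbertSpace (R : realType) (k : scalar_kind) := HilbertSpace {
  hcarrier :> completeNormedModType (scalar_field R k) ;
  inner : {dot hcarrier for @conj_scalar R k} ;
  inner_norm : forall x : hcarrier, inner x x = `|x| ^+ 2 }.

Arguments inner {R k} h.

Section Operators.
Context (R : realType) (k : scalar_kind) (H : hilbertSpace R k).

Definition self_adjoint (A : {linear H -> H}) :=
  forall x y : H, inner H (A x) y = inner H x (A y).

Definition nonnegative (A : {linear H -> H}) :=
  forall x : H, 0 <= inner H (A x) x.

Definition compact_operator (A : {linear H -> H}) :=
  forall B : set H, bounded_set B -> precompact (A @` B).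

Definition op_eigenspace (A : {linear H -> H}) (mu : R) : set H :=
  [set x | A x = of_real k mu *: x].

Definition has_dim (V : set H) (d : nat) := exists v : 'I_d -> H,
  (forall c : 'I_d -> scalar_field R k,
     \sum_(i < d) c i *: v i = 0 -> forall i, c i = 0) /\
  V = [set x | exists c : 'I_d -> scalar_field R k, x = \sum_(i < d) c i *: v i].

(* The positive eigenvalues in nonincreasing order, repeated according to
   multiplicity; indexing starts at 0, and if there are only finitely many
   of them the sequence continues with zeros. *)
Definition is_eigenvalue_seq (A : {linear H -> H}) (lam : nat -> R) :=
  [/\ nonincreasing_seq lam,
      forall n, 0 <= lam n &
      forall mu : R, 0 < mu -> finite_set [set n | lam n = mu] /\
        has_dim (op_eigenspace A mu) #|` fset_set [set n | lam n = mu] | ].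

(* Chosen among the sequences above; the constant 0 is a dummy value for
   operators that have no such sequence. *)
Definition op_eigenvalue (A : {linear H -> H}) : nat -> R :=
  xget (fun=> 0) [set lam | is_eigenvalue_seq A lam].

Definition counting_function (t : R) (A : {linear H -> H}) : R :=
  #|` fset_set [set n | t < op_eigenvalue A n] |%:R.

End Operators.

(* A realization of the Hilbert tensor product of H1 and H2, which is
   determined up to a unitary isomorphism respecting elementary tensors. *)
Record hilbertTensor (R : realType) (k : scalar_kind)
    (H1 H2 : hilbertSpace R k) := HilbertTensor {
  tcarrier :> hilbertSpace R k ;
  tens : {bilinear H1 -> H2 -> tcarrier} ;
  inner_tens : forall (x x' : H1) (y y' : H2),
    inner tcarrier (tens x y) (tens x' y') = inner H1 x x' * inner H2 y y' ;
  tens_dense : dense [set z : tcarrier |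
    exists (n : nat) (x : 'I_n -> H1) (y : 'I_n -> H2),
      z = \sum_(i < n) tens (x i) (y i)] }.

Arguments tens {R k H1 H2} h.

(* A is the bounded operator determined by its values on elementary tensors. *)
Definition is_tensor_operator (R : realType) (k : scalar_kind)
    (H1 H2 : hilbertSpace R k) (HH : hilbertTensor H1 H2)
    (A1 : {linear H1 -> H1}) (A2 : {linear H2 -> H2})
    (A : {linear HH -> HH}) :=
  continuous A /\
  forall (x : H1) (y : H2), A (tens HH x y) = tens HH (A1 x) (A2 y).

Section SlowlyVarying.
Context (R : realType).
Implicit Types phi psi : R -> R.

Definition slowly_varying phi :=
  [/\ forall tau, 0 < tau -> 0 < phi tau,
      measurable_fun (`]0, +oo[ : set R) phi &
      forall c, 0 < c -> phi (c * tau) / phi tau @[tau --> +oo] --> (1 : R)].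

Definition C2_positive phi := forall tau : R, 0 < tau ->
  [/\ derivable phi tau 1, derivable (derive1 phi) tau 1 &
      {for tau, continuous (derive1n 2 phi)}].

Definition smooth_slowly_varying phi :=
  [/\ slowly_varying phi, C2_positive phi,
      tau * derive1 (@ln R \o phi) tau @[tau --> +oo] --> (0 : R) &
      tau ^+ 2 * derive1n 2 (@ln R \o phi) tau @[tau --> +oo] --> (0 : R)].

Definition mellin_convolution phi psi (tau : R) : R :=
  \int[lebesgue_measure]_(sigma in `[1, tau])
     (phi sigma * psi (tau / sigma) / sigma).

Definition log_integral phi : \bar R :=
  (\int[lebesgue_measure]_(tau in `[1%R, +oo[) (phi tau / tau)%:E)%E.

(* Here s need not have T as its least period. *)
Definition admissible_periodic (p T : R) (s : R -> R) :=
  [/\ 0 < T, periodic s T, continuous s,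
      exists m M : R, 0 < m /\ forall x, m <= s x <= M &
      exists rho : R -> R,
        ({homo rho : x y / x <= y} \/ {homo rho : x y /~ x <= y}) /\
        forall tau, s tau = expR (- tau / p) * rho tau].

Definition mean_value (T : R) (s : R -> R) : R :=
  T^-1 * \int[lebesgue_measure]_(t in `[0, T]) s t.

End SlowlyVarying.

(* Main.v *)
(** The eigenvalues of the tensor product are the products [lambda_i mu_j], so
    with [x = ln (1 / t)], [a = 1 / p], [f_k x = phi_k (e^x)] the counting
    function is [N x = #{(i, j) | x_i + y_j < x}], where [x_i = - ln lambda_i]
    and [y_j = - ln mu_j].  Fix a window of length [Q T1], cut into cells of
    length [T1 / m].  When [x_i] runs through one window, [f_1] and [f_2] are
    nearly constant, and the number of pairs is
    [e^(a x) f_1 f_2 sum_r d_r s_2 (x - z_r)], where the weights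
    [d_r = e^(a h) s_1 (z_r + h) - s_1 z_r >= 0] are [T1]-periodic with sum
    nearly [a T1 M_1] over a period.  As [T1 / T2] is irrational, averaging over
    the [Q] periods replaces [s_2] by its mean [M_2], so each window contributes
    [a M_1 M_2 e^(a x)] times its share of the convolution [f_1 * f_2].  The
    pairs with [x_i] or [y_j] bounded contribute [O (e^(a x) (f_1 x + f_2 x))],
    which is negligible because [f_1] and [f_2] have infinite integrals. *)

Require Import Defs.
From HB Require Import structures.
From mathcomp Require Import all_boot all_order all_algebra.
From mathcomp Require Import sesquilinear complex finmap.
From mathcomp Require Import all_classical all_reals all_analysis.
From mathcomp Require Import ring lra.
Set Implicit Arguments.
Unset Strict Implicit.
Unset Printing Implicit Defensive.
Import Order.TTheory GRing.Theory Num.Theory.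
Import numFieldNormedType.Exports.
Local Open Scope ring_scope.
Local Open Scope classical_set_scope.

(** * Hilbert spaces over the real or complex numbers *)

(** The order of the choices shapes the analytic half. A relative error [eta] in the asymptotics of
    [N1] says nothing about its increment over a cell, whose own relative size is of order [1 / m].
    So [eps] first fixes [m] and [Q]; then [eta] is taken small against [m] and the total weight of
    a period; the threshold in [x] comes last. Windows have fixed length, so slow variation freezes
    [f_1] and [f_2] on them, and they start at multiples of [T1], so they all carry the same
    weights. The weights are nonnegative because [e^(a x) s_1 x] is monotone; this is what allows
    estimates of [s_2] to be summed against them.

    On the operator side, eigenvalues are chosen with a dummy default. The asymptotics of the
    factors certify that their sequences are genuine, since the counts do not vanish near 0; for the
    tensor product a sequence has to be constructed. Completeness of eigenvectors is used only
    through orthogonality: a vector orthogonal to enough of them is orthogonal to a range or an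
    eigenspace, so no infinite expansion appears. *)

Section Scalars.
Context (R : realType) (k : scalar_kind).
Notation K := (scalar_field R k).
Notation conj := (@conj_scalar R k).
Notation of_real := (@of_real R k).

Definition real_part : K -> R :=
  match k return scalar_field R k -> R with
  | RealScalars => idfun
  | ComplexScalars => @complex.Re R
  end.

Lemma conj_scalar_zmod : zmod_morphism conj.
Proof. by rewrite /conj; case: k => x y //=; rewrite rmorphB. Qed.

Lemma conj_scalar_monoid : monoid_morphism conj.
Proof. by rewrite /conj; case: k; split=> //= [|x y]; rewrite ?rmorph1 ?rmorphM. Qed.

Lemma of_real_zmod : zmod_morphism of_real.
Proof. by rewrite /of_real; case: k => x y //=; rewrite rmorphB. Qed.

Lemma of_real_monoid : monoid_morphism of_real.
Proof. by rewrite /of_real; case: k; split=> //= [x y]; rewrite ?rmorph1 ?rmorphM. Qed.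

Lemma real_part_zmod : zmod_morphism real_part.
Proof. by rewrite /real_part; case: k => x y //=; rewrite raddfB. Qed.

HB.instance Definition _ := GRing.isZmodMorphism.Build K K conj conj_scalar_zmod.
HB.instance Definition _ := GRing.isMonoidMorphism.Build K K conj conj_scalar_monoid.
HB.instance Definition _ := GRing.isZmodMorphism.Build R K of_real of_real_zmod.
HB.instance Definition _ := GRing.isMonoidMorphism.Build R K of_real of_real_monoid.
HB.instance Definition _ := GRing.isZmodMorphism.Build K R real_part real_part_zmod.

Lemma of_realK : cancel of_real real_part.
Proof. by rewrite /of_real /real_part; case: k. Qed.

Lemma of_real_le : {mono of_real : x y / x <= y}.
Proof. by rewrite /of_real; case: k => x y //=; rewrite lecR. Qed.

Lemma real_part_geK (a : K) : 0 <= a -> of_real (real_part a) = a.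
Proof.
rewrite /of_real /real_part; move: a; case: k => //= a a0.
by rewrite RRe_real// ger0_real.
Qed.

Lemma conj_of_real (r : R) : conj (of_real r) = of_real r.
Proof.
rewrite /conj /of_real; case: k => //=.
by apply: conj_Creal; rewrite complex_real.
Qed.

Lemma mul_conj (a : K) : a * conj a = `|a| ^+ 2.
Proof.
rewrite /conj; move: a; case: k => //= a; first by rewrite -expr2 real_normK// num_real.
by rewrite normCK.
Qed.

Lemma real_partZ (r : R) (a : K) : real_part (of_real r * a) = r * real_part a.
Proof.
by move: a; rewrite /real_part /of_real; case: k => //= -[x y] /=; rewrite mul0r subr0.
Qed.

Lemma real_part_ge0 (a : K) : 0 <= a -> 0 <= real_part a.
Proof. by move=> a0; rewrite -of_real_le rmorph0 real_part_geK. Qed.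

End Scalars.

Arguments of_real_le {R} k.

Section Hilbert.
Context (R : realType) (k : scalar_kind) (H : hilbertSpace R k).
Notation K := (scalar_field R k).
Notation conj := (@conj_scalar R k).
Notation of_real := (@of_real R k).
Notation "''[' u , v ]" := (inner H u v).
Implicit Types x y z : H.

Lemma innerBl x y z : '[x - y, z] = '[x, z] - '[y, z].
Proof. exact: linearBl. Qed.
Lemma innerZl a x z : '[a *: x, z] = a * '[x, z].
Proof. exact: linearZl_LR. Qed.
Lemma inner_suml I (r : seq I) (P : pred I) (F : I -> H) z :
  '[\sum_(i <- r | P i) F i, z] = \sum_(i <- r | P i) '[F i, z].
Proof. exact: linear_sumlz. Qed.
Lemma innerC x y : '[x, y] = conj '[y, x].
Proof. by rewrite hermC expr0 mul1r. Qed.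
Lemma inner0l z : '[0, z] = 0.
Proof. exact: linear0l. Qed.
Lemma innerBr x y z : '[x, y - z] = '[x, y] - '[x, z].
Proof. by rewrite innerC innerBl rmorphB/= -!innerC. Qed.
Lemma innerZr a x z : '[x, a *: z] = conj a * '[x, z].
Proof. by rewrite innerC innerZl rmorphM/= -innerC. Qed.
Lemma inner0r z : '[z, 0] = 0.
Proof. by rewrite innerC inner0l rmorph0. Qed.
Lemma inner_eq0C x y : '[x, y] = 0 -> '[y, x] = 0.
Proof. by move=> xy; rewrite innerC xy rmorph0. Qed.

Lemma inner_eq0 x : '[x, x] = 0 -> x = 0.
Proof. by rewrite inner_norm => /eqP; rewrite expf_eq0/= normr_eq0 => /eqP. Qed.

(** Cauchy-Schwarz: the squared norm of ['[y, y] *: x - '[x, y] *: y] expands to ['[y, y]] times the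
    difference of the squares of the two sides. *)
Lemma norm_inner_le x y : `|'[x, y]| <= `|x| * `|y|.
Proof.
have [->|y0] := eqVneq y 0; first by rewrite inner0r !normr0 mulr0.
have ny0 : 0 < `|y| ^+ 2 by rewrite exprn_gt0// normr_gt0.
have : 0 <= '['[y, y] *: x - '[x, y] *: y, '[y, y] *: x - '[x, y] *: y].
  by rewrite inner_norm exprn_ge0.
rewrite innerBl !innerBr !innerZl !innerZr -(innerC y y) -(innerC y x).
have -> : '[y, y] * ('[y, y] * '[x, x]) - '[y, y] * ('[y, x] * '[x, y]) -
   ('[x, y] * ('[y, y] * '[y, x]) - '[x, y] * ('[y, x] * '[y, y])) =
   '[y, y] * ('[y, y] * '[x, x] - '[x, y] * '[y, x]) by ring.
rewrite (innerC y x) mul_conj !inner_norm pmulr_rge0// subr_ge0 -exprMn => h.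
by rewrite -(@ler_pXn2r _ 2)// ?nnegrE ?mulr_ge0// mulrC.
Qed.

(** Norms of [H] take values in the scalar field; this copy in [R] gives access to suprema, the
    archimedean property and [lra]. *)
Definition rnorm x : R := real_part `|x|.

Lemma of_rnorm x : of_real (rnorm x) = `|x|.
Proof. exact: real_part_geK. Qed.

Lemma rnorm_ge0 x : 0 <= rnorm x.
Proof. exact: real_part_ge0. Qed.

Lemma le_rnorm (x : H) (r : R) : (rnorm x <= r) = (`|x| <= of_real r).
Proof. by rewrite -(of_real_le k) of_rnorm. Qed.

Lemma rnormD x y : rnorm (x + y) <= rnorm x + rnorm y.
Proof. by rewrite le_rnorm rmorphD /= !of_rnorm ler_normD. Qed.

Lemma rnormB x y : rnorm (x - y) = rnorm (y - x).
Proof. by rewrite /rnorm distrC. Qed.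

Lemma rnorm0 : rnorm 0 = 0.
Proof. by rewrite /rnorm normr0 raddf0. Qed.

Lemma rnorm0_eq0 x : rnorm x <= 0 -> x = 0.
Proof. by rewrite le_rnorm rmorph0 normr_le0 => /eqP. Qed.

Lemma rnormZ (r : R) x : 0 <= r -> rnorm (of_real r *: x) = r * rnorm x.
Proof.
move=> r0; rewrite /rnorm normrZ ger0_norm ?real_partZ//.
by rewrite -(rmorph0 of_real) of_real_le.
Qed.

Lemma rnorm_sqr x : rnorm x ^+ 2 = real_part '[x, x].
Proof.
by rewrite inner_norm -of_rnorm -rmorphXn of_realK.
Qed.

End Hilbert.

Lemma ler0_eps (R : realType) (a c : R) : 0 <= c ->
  (forall d, 0 < d -> a <= c * d) -> a <= 0.
Proof.
move=> c0 h; rewrite leNgt; apply/negP => a0.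
have c1 : 0 < c + 1 by lra.
have := h (a / (c + 1)) (divr_gt0 a0 c1).
rewrite mulrA ler_pdivlMr//; nra.
Qed.

Section Compact.
Context (R : realType) (k : scalar_kind) (H : hilbertSpace R k).
Notation K := (scalar_field R k).
Notation of_real := (@of_real R k).
Notation "''[' u , v ]" := (inner H u v).
Variable A : {linear H -> H}.
Hypothesis cA : compact_operator A.

(** The images lie in a compact set, so the filter of tails clusters. A good index beyond any [N] is
    enough for what follows, so no subsequence is extracted. *)
Lemma compact_operator_cluster (u : nat -> H) (M : R) :
  (forall n, rnorm (u n) <= M) ->
  exists y, forall (d : R) N, 0 < d -> exists2 n, (N <= n)%N & rnorm (A (u n) - y) <= d.
Proof.
move=> uM; have : bounded_set [set x : H | rnorm x <= M].
  exists (of_real M); split.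
    by rewrite realE -(rmorph0 of_real) !of_real_le -realE num_real.
  by move=> x Mx y /=; rewrite le_rnorm => /le_trans; apply; exact: ltW.
move=> /cA [U AU [cU _]].
have FU : ((fun n => A (u n)) @ \oo) U.
  by exists 0%N => // n _; apply: AU; exists (u n) => //=; exact: uM.
have [y [_ yc]] := cU _ _ FU.
exists y => d N d0.
have [| |_ [[n Nn <-]]] := yc [set z | exists2 n, (N <= n)%N & A (u n) = z] (ball y (of_real d)).
- by exists N => // n Nn; exists n.
- by apply: nbhsx_ballx; rewrite lt_def -(rmorph0 of_real) of_real_le ltW// (inj_eq (fmorph_inj _)) gt_eqF.
by rewrite -ball_normE /= => /ltW h; exists n => //; rewrite rnormB le_rnorm.
Qed.

End Compact.

(** * Compact nonnegative self-adjoint operators *)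

Section CompactNorm.
Context (R : realType) (k : scalar_kind) (H : hilbertSpace R k).
Notation K := (scalar_field R k).
Notation conj := (@conj_scalar R k).
Notation of_real := (@of_real R k).
Notation "''[' u , v ]" := (inner H u v).
Variable A : {linear H -> H}.
Hypothesis (cA : compact_operator A) (saA : self_adjoint A) (nnA : nonnegative A).

Section AboveLevel.
Variable eps : R.
Hypothesis eps0 : 0 <= eps.

Let W : set H := [set x | forall mu e, eps < mu -> A e = of_real mu *: e -> '[x, e] = 0].

Let W0 : W 0. Proof. by move=> mu e _ _; rewrite inner0l. Qed.

Let WB x y : W x -> W y -> W (x - y).
Proof. by move=> Wx Wy mu e m Ae; rewrite innerBl (Wx _ _ m Ae) (Wy _ _ m Ae) subrr. Qed.

Let WZ a x : W x -> W (a *: x).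
Proof. by move=> Wx mu e m Ae; rewrite innerZl (Wx _ _ m Ae) mulr0. Qed.

Let WA x : W x -> W (A x).
Proof. by move=> Wx mu e m Ae; rewrite saA Ae innerZr (Wx _ _ m Ae) mulr0. Qed.

Let S : set R := [set rnorm (A x) | x in [set x | W x /\ rnorm x <= 1]].

(** Boundedness from compactness: if [rnorm (A (u n))] exceeded [n] for unit-ball vectors [u n],
    infinitely many of these norms would still be at most [rnorm y + 1] at a cluster point [y]. *)
Let S_sup : has_sup S.
Proof.
split; first by exists (rnorm (A 0)), 0; [split=> //; rewrite rnorm0|].
apply: contrapT => nS.
have /choice[u uP] : forall n : nat, exists x, [/\ W x, rnorm x <= 1 & n%:R < rnorm (A x)].
  move=> n; apply: contrapT => nx; apply: nS; exists n%:R => _ [x [Wx x1] <-].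
  by rewrite leNgt; apply/negP => h; apply: nx; exists x.
have [|y yP] := @compact_operator_cluster _ _ _ _ cA u 1; first by move=> n; have [] := uP n.
have [n Nn /=] := yP 1 (Num.bound (rnorm y + 1)) ltr01.
have [_ _ un] := uP n.
have yb : rnorm y + 1 < (Num.bound (rnorm y + 1))%:R.
  by apply: archi_boundP; rewrite addr_ge0 ?rnorm_ge0.
have nb : (Num.bound (rnorm y + 1))%:R <= n%:R :> R by rewrite ler_nat.
have := rnormD (A (u n) - y) y; rewrite subrK; lra.
Qed.

Let m := sup S.

Let m_ub x : W x -> rnorm (A x) <= m * rnorm x.
Proof.
move=> Wx; have [->|x0] := eqVneq x 0; first by rewrite linear0 rnorm0 mulr0.
have nx : 0 < rnorm x.
  by rewrite ltNge; apply/negP => /rnorm0_eq0 /eqP; apply/negP.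
have nx0 := ltW nx; rewrite -ler_pdivrMr// mulrC -rnormZ ?invr_ge0// -linearZ.
apply: (sup_upper_bound S_sup); eexists; last reflexivity.
by split; [exact: WZ|rewrite rnormZ ?invr_ge0// mulVf// gt_eqF].
Qed.

(** Expand the square, using self-adjointness for the cross terms, and insert
    [rnorm (A (A x)) <= m * rnorm (A x)]. A maximizing sequence is therefore asymptotically made of
    eigenvectors of [A] squared. *)
Let approx x : 0 <= m -> W x -> rnorm x <= 1 ->
  rnorm (A (A x) - of_real (m ^+ 2) *: x) ^+ 2 <= m ^+ 2 * (m ^+ 2 - rnorm (A x) ^+ 2).
Proof.
move=> m0 Wx x1.
have -> : rnorm (A (A x) - of_real (m ^+ 2) *: x) ^+ 2 =
    rnorm (A (A x)) ^+ 2 - m ^+ 2 * rnorm (A x) ^+ 2 *+ 2 + m ^+ 2 * (m ^+ 2 * rnorm x ^+ 2).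
  rewrite rnorm_sqr innerBl !innerBr !innerZl !innerZr conj_of_real.
  rewrite (saA (A x) x) -(saA x (A x)) !raddfB /= !real_partZ -!rnorm_sqr; ring.
have x2 : rnorm x ^+ 2 <= 1 by rewrite expr_le1 ?rnorm_ge0.
have r2 : rnorm (A (A x)) ^+ 2 <= m ^+ 2 * rnorm (A x) ^+ 2.
  by rewrite -exprMn lerXn2r ?nnegrE ?mulr_ge0 ?rnorm_ge0// m_ub//; exact: WA.
have := ler_wpM2l (exprn_ge0 2 (exprn_ge0 2 m0)) x2; nra.
Qed.

(* If the norm [m] of [A] on the invariant subspace [W] exceeded [eps], a
   maximizing sequence would cluster at some [y <> 0] in [W] with
   [A (A y) = m ^+ 2 y]; nonnegativity excludes the eigenvalue [- m], so [y] is
   an eigenvector for [m], hence orthogonal to itself. *)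
Lemma rnorm_orth_eigen x : W x -> rnorm (A x) <= eps * rnorm x.
Proof.
move=> Wx; rewrite leNgt; apply/negP => lx.
have nx : 0 < rnorm x.
  rewrite ltNge; apply/negP => /rnorm0_eq0 x0.
  by move: lx; rewrite x0 linear0 rnorm0 mulr0 ltxx.
have em : eps < m by rewrite -(ltr_pM2r nx) (lt_le_trans lx)// m_ub.
have m0 : 0 < m by exact: le_lt_trans em.
have /choice[u uP] : forall n : nat, exists z,
    [/\ W z, rnorm z <= 1 & m - n.+1%:R^-1 < rnorm (A z)].
  move=> n; have n1 : (0 : R) < n.+1%:R^-1 by rewrite invr_gt0.
  by have [_ [z [Wz z1] <-] h] := sup_adherent n1 S_sup; exists z.
have [|y yP] := @compact_operator_cluster _ _ _ _ cA u 1; first by move=> n; have [] := uP n.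
(* [W] is closed: [A (u n)] lies in [W], so ['[y, e]] only sees the small difference
   [A (u n) - y]. *)
have Wy : W y.
  move=> mu e mue Ae; apply/eqP; rewrite -normr_le0 -(real_part_geK (normr_ge0 _)).
  rewrite -(rmorph0 of_real) of_real_le.
  apply: (@ler0_eps _ _ (rnorm e)) => [|d d0]; first exact: rnorm_ge0.
  have [n _ nd] := yP d 0%N d0; have [Wu _ _] := uP n.
  rewrite -(of_real_le k) real_part_geK// rmorphM /= of_rnorm mulrC.
  have -> : '[y, e] = - '[A (u n) - y, e] by rewrite innerBl (WA Wu mue Ae) sub0r opprK.
  rewrite normrN (le_trans (norm_inner_le _ _))// ler_wpM2r//.
  by rewrite -of_rnorm of_real_le.
have small d : 0 < d -> exists n, [/\ rnorm (A (u n) - y) <= d,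
    rnorm (A (A (u n)) - of_real (m ^+ 2) *: u n) <= d & m - d <= rnorm (A (u n))].
  move=> d0; set B := (2 * m ^+ 3 / d ^+ 2 + d^-1).
  have B0 : 0 <= B by rewrite addr_ge0 ?divr_ge0 ?mulr_ge0 ?exprn_ge0 ?invr_ge0 ?ltW.
  have [n Nn nd] := yP d (Num.bound B) d0; exists n; have [Wu u1 un] := uP n.
  have nB : B < n.+1%:R.
    apply: lt_le_trans (archi_boundP B0) _.
    by rewrite ler_nat (leq_trans Nn).
  set q : R := n.+1%:R^-1 in un.
  have q0 : 0 < q by rewrite invr_gt0.
  have qn : q * n.+1%:R = 1 by rewrite mulVf.
  have qB : q * B < 1 by rewrite -qn ltr_pM2l.
  have d20 : 0 < d ^+ 2 by rewrite exprn_gt0.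
  have qd : q <= d.
    have : q * d^-1 <= 1.
      apply: le_trans (ltW qB); rewrite ler_pM2l// lerDr.
      by rewrite divr_ge0 ?mulr_ge0 ?exprn_ge0 ?ltW.
    by rewrite ler_pdivrMr// mul1r.
  have qm : 2 * m ^+ 3 * q <= d ^+ 2.
    have : q * (2 * m ^+ 3 / d ^+ 2) <= 1.
      by apply: le_trans (ltW qB); rewrite ler_pM2l// lerDl invr_ge0 ltW.
    by rewrite mulrA ler_pdivrMr// mul1r mulrC.
  split=> //; last by lra.
  have d0' := ltW d0; rewrite -(@ler_pXn2r _ 2)// ?nnegrE ?rnorm_ge0//.
  apply: le_trans (approx (ltW m0) Wu u1) _; apply: le_trans qm.
  have um : rnorm (A (u n)) <= m.
    by apply: le_trans (m_ub Wu) _; rewrite ger_pMr.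
  have -> : 2 * m ^+ 3 * q = m ^+ 2 * (2 * m * q) by ring.
  rewrite ler_pM2l ?exprn_gt0//.
  have := rnorm_ge0 (A (u n)); nra.
have AAy : A (A y) - of_real (m ^+ 2) *: y = 0.
  apply: rnorm0_eq0; apply: (@ler0_eps _ _ (2 * m ^+ 2 + m)) => [|d d0].
    by rewrite addr_ge0 ?mulr_ge0 ?exprn_ge0 ?ltW.
  have [n [n1 n2 _]] := small d d0; have [Wu _ _] := uP n.
  set v := A (u n) in n1 n2.
  have Wv : W (v - y) by apply: WB => //; exact: WA.
  have -> : A (A y) - of_real (m ^+ 2) *: y = A (A (y - v)) +
      (A (A v - of_real (m ^+ 2) *: u n) + of_real (m ^+ 2) *: (v - y)).
    have -> : A (A (y - v)) = A (A y) - A (A v) by rewrite !linearB.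
    have -> : A (A v - of_real (m ^+ 2) *: u n) = A (A v) - of_real (m ^+ 2) *: v.
      by rewrite linearB linearZ.
    by rewrite scalerBr [A (A v) - _ + _]addrA subrK addrA subrK.
  have h1 : rnorm (A (A (y - v))) <= m * (m * d).
    apply: le_trans (m_ub _) _; first by apply: WA; rewrite -opprB -scaleN1r; exact: WZ.
    rewrite ler_pM2l//; apply: le_trans (m_ub _) _; first by rewrite -opprB -scaleN1r; exact: WZ.
    by rewrite ler_pM2l// rnormB.
  have h2 : rnorm (A (A v - of_real (m ^+ 2) *: u n)) <= m * d.
    apply: le_trans (m_ub _) _; last by rewrite ler_pM2l.
    by apply: WB; [do 2!apply: WA|exact: WZ].
  have h3 : rnorm (of_real (m ^+ 2) *: (v - y)) <= m ^+ 2 * d.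
    by rewrite rnormZ ?exprn_ge0 ?(ltW m0)// ler_pM2l// exprn_gt0.
  apply: le_trans (rnormD _ _) _; have := rnormD (A (A v - of_real (m ^+ 2) *: u n)) (of_real (m ^+ 2) *: (v - y)).
  have -> : (2 * m ^+ 2 + m) * d = m * (m * d) + (m * d + m ^+ 2 * d) by ring.
  lra.
have y_neq0 : y <> 0.
  move=> y0; have [|n [n1 _ n2]] := small (m / 3) _; first by rewrite divr_gt0.
  by move: n1; rewrite y0 subr0; lra.
pose w := A y - of_real m *: y.
have Aw : A w = - (of_real m *: w).
  rewrite /w linearB /= linearZ /= scalerBr scalerA -rmorphM -expr2 opprB.
  by have /eqP := AAy; rewrite subr_eq0 => /eqP ->.
have w0 : w = 0.
  apply: rnorm0_eq0; have := real_part_ge0 (nnA w).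
  rewrite Aw -scaleNr innerZl -rmorphN real_partZ -rnorm_sqr mulNr oppr_ge0.
  rewrite pmulr_rle0// => h; have := rnorm_ge0 w; nra.
apply: y_neq0; apply: inner_eq0; apply: (Wy m) => //.
by apply/eqP; rewrite -subr_eq0; apply/eqP.
Qed.

End AboveLevel.
End CompactNorm.

(** * Orthonormal systems and dimension *)

Section Orthonormal.
Context (R : realType) (k : scalar_kind) (H : hilbertSpace R k).
Notation K := (scalar_field R k).
Notation conj := (@conj_scalar R k).
Notation of_real := (@of_real R k).
Notation "''[' u , v ]" := (inner H u v).

(** The last clause is the dual form of the inclusion of the span of [v] in that of [u]; this is the
    form in which completeness is used later. *)
Lemma gram_schmidt (v : nat -> H) d :
  (forall c : nat -> K, \sum_(i < d) c i *: v i = 0 ->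
     forall i, (i < d)%N -> c i = 0) ->
  exists u : nat -> H,
  [/\ forall i j, (i < d)%N -> (j < d)%N -> '[u i, u j] = (i == j)%:R,
      forall i, (i < d)%N -> exists c : nat -> K, u i = \sum_(j < d) c j *: v j &
      forall x, (forall i, (i < d)%N -> '[x, u i] = 0) ->
        forall i, (i < d)%N -> '[x, v i] = 0].
Proof.
elim: d => [_|d IH fr]; first by exists v; split.
have {}/IH[u [ou su uv]] : forall c : nat -> K, \sum_(i < d) c i *: v i = 0 ->
    forall i, (i < d)%N -> c i = 0.
  move=> c c0 i id; have := fr (fun j => if (j < d)%N then c j else 0).
  rewrite big_ord_recr /= ltnn scale0r addr0.
  under eq_bigr do rewrite ltn_ord.
  by move=> /(_ c0 i (ltnW id)); rewrite id.
pose w := v d - \sum_(i < d) '[v d, u i] *: u i.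
have wu i : (i < d)%N -> '[w, u i] = 0.
  move=> id; rewrite /w innerBl inner_suml (bigD1 (Ordinal id))//= big1 ?addr0.
    by rewrite innerZl ou// eqxx mulr1 subrr.
  move=> j ji; rewrite innerZl ou// -(inj_eq val_inj) /= in ji *.
  by rewrite (negbTE ji) mulr0.
have [cu cuP] : exists cu : nat -> nat -> K, forall i, (i < d)%N ->
    u i = \sum_(j < d) cu i j *: v j.
  have /choice[cu cuP] : forall i, exists c : nat -> K, (i < d)%N ->
      u i = \sum_(j < d) c j *: v j.
    move=> i; have [id|_] := boolP (i < d)%N; last by exists (fun=> 0).
    by have [c cP] := su i id; exists c.
  by exists cu.
(* The coefficient of [v d] in [w] is 1, so freeness of the family excludes [w = 0]. *)
have wv : exists2 c : nat -> K, w = \sum_(j < d.+1) c j *: v j & c d = 1.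
  exists (fun j => if (j < d)%N then - \sum_(i < d) '[v d, u i] * cu i j else 1); last by rewrite ltnn.
  rewrite big_ord_recr /= ltnn scale1r addrC /w; congr (_ + _).
  under [RHS]eq_bigr do rewrite ltn_ord scaleNr scaler_suml.
  rewrite sumrN exchange_big /=; congr (- _); apply: eq_bigr => i _.
  rewrite {2}(cuP i)// scaler_sumr; apply: eq_bigr => j _.
  by rewrite scalerA.
have w0 : w != 0.
  apply/eqP => w0; have [c cw cd] := wv.
  have := fr c; rewrite -cw => /(_ w0 d (ltnSn d)); rewrite cd => /eqP.
  by rewrite oner_eq0.
pose r : K := (`|w|)^-1.
have rr : conj r = r.
  by rewrite /r -of_rnorm -fmorphV conj_of_real.
exists (fun i => if (i < d)%N then u i else r *: w); split.
- move=> i j; rewrite !ltnS => id jd.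
  case: ltnP => id'; case: ltnP => jd'.
  + exact: ou.
  + have -> : (i == j) = false by apply: ltn_eqF; exact: leq_trans jd'.
    by rewrite innerZr (inner_eq0C (wu i id')) mulr0.
  + have -> : (i == j) = false by apply: gtn_eqF; exact: leq_trans id'.
    by rewrite innerZl wu// mulr0.
  + have -> : (i == j) by apply/eqP/anti_leq; rewrite (leq_trans id)// (leq_trans jd).
    rewrite innerZl innerZr rr inner_norm mulrA -expr2 /r -exprMn mulVf ?expr1n//.
    by rewrite normr_eq0.
- move=> i; rewrite ltnS => id; case: ltnP => id'.
    exists (fun j => if (j < d)%N then cu i j else 0).
    rewrite big_ord_recr /= ltnn scale0r addr0 cuP//.
    by apply: eq_bigr => j _; rewrite ltn_ord.
  have [c cw _] := wv; exists (fun j => r * c j).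
  by rewrite cw scaler_sumr; apply: eq_bigr => j _; rewrite scalerA.
- move=> x xu.
  have xu' i : (i < d)%N -> '[x, u i] = 0.
    by move=> id; have := xu i (ltnW id); rewrite id.
  move=> i; rewrite ltnS leq_eqVlt => /predU1P[->|]; last exact: uv.
  have := xu d (ltnSn d); rewrite ltnn innerZr => /eqP.
  rewrite mulf_eq0 rr invr_eq0 normr_eq0 (negbTE w0) /= => /eqP.
  rewrite /w innerBr (innerC x (\sum_(_ < _) _)) inner_suml big1 ?rmorph0 ?subr0//.
  by move=> j _; rewrite innerZl (inner_eq0C (xu' _ _)) ?mulr0.
Qed.

(** One basis written in the other gives a matrix with independent rows, and its rank is at most the
    number of columns. *)
Lemma has_dim_unique (V : set H) d d' : has_dim V d -> has_dim V d' -> d = d'.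
Proof.
wlog suff : d d' / has_dim V d -> has_dim V d' -> (d <= d')%N.
  by move=> h V1 V2; apply/anti_leq; rewrite (h _ _ V1 V2) (h _ _ V2 V1).
move=> [v [fr Vv]] [w [_ Vw]].
have /choice[M MP] : forall i, exists c : 'I_d' -> K, v i = \sum_(j < d') c j *: w j.
  move=> i; have : V (v i).
    rewrite Vv; exists (fun j => (j == i)%:R); rewrite (bigD1 i)//= eqxx scale1r big1 ?addr0// => j.
    by move=> /negbTE ->; rewrite scale0r.
  by rewrite Vw.
pose B : 'M[K]_(d, d') := \matrix_(i, j) M i j.
suff : row_free B by rewrite /row_free => /eqP <-; exact: rank_leq_col.
rewrite -kermx_eq0; apply/eqP/row_matrixP => i; rewrite row0.
have kB : row i (kermx B) *m B = 0 by rewrite -row_mul mulmx_ker row0.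
apply/rowP => j; rewrite [RHS]mxE; apply: (fr (fun j => row i (kermx B) 0 j)).
under eq_bigr do rewrite MP scaler_sumr.
rewrite exchange_big big1//= => l _; under eq_bigr do rewrite scalerA.
rewrite -scaler_suml.
have /rowP/(_ l) := kB; rewrite !mxE => e; rewrite (_ : \sum_(_ < _) _ = 0) ?scale0r//.
by rewrite -[RHS]e; apply: eq_bigr => m _; rewrite [B _ _]mxE.
Qed.

(** Spanning follows from the last hypothesis: [x] minus its projection on the [g i] is in [V] and
    orthogonal to all of them, hence zero. *)
Lemma has_dim_orthonormal (I : choiceType) (D : {fset I}) (g : I -> H) (V : set H) :
  {in D &, forall i j, '[g i, g j] = (i == j)%:R} ->
  (forall i, i \in D -> V (g i)) ->
  (forall a x y, V x -> V y -> V (a *: x + y)) -> V 0 ->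
  (forall x, V x -> (forall i, i \in D -> '[x, g i] = 0) -> x = 0) ->
  has_dim V #|` D|.
Proof.
move=> og Vg VP V0 gV.
pose v i := g (tnth (in_tuple (enum_fset D)) i).
have inD i : tnth (in_tuple (enum_fset D)) i \in D by apply: (mem_tnth i (in_tuple (enum_fset D))).
have ov i j : '[v i, v j] = (i == j)%:R.
  rewrite /v og//; congr ((_ : bool)%:R); apply: inj_eq; apply/tuple_uniqP.
  exact: fset_uniq.
have co c i : '[\sum_j c j *: v j, v i] = c i.
  rewrite inner_suml (bigD1 i)//= innerZl ov eqxx mulr1 big1 ?addr0// => j ji.
  by rewrite innerZl ov (negbTE ji) mulr0.
have Vs (c : 'I_#|` D| -> K) : V (\sum_j c j *: v j).
  by elim/big_ind: _ => // [x y Vx Vy|i _]; [rewrite -[x]scale1r; exact: VP|rewrite -[_ *: _]addr0; apply: VP => //; exact: Vg].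
exists v; split=> [c c0 i|]; first by rewrite -(co c i) c0 inner0l.
apply/seteqP; split=> [x Vx|_ [c ->]]; last exact: Vs.
exists (fun i => '[x, v i]); apply/eqP; rewrite -subr_eq0; apply/eqP; apply: gV.
  by rewrite addrC -scaleN1r; apply: VP.
move=> i iD; have [j ->] : exists j, g i = v j.
  by have /tnthP[j ij] : i \in in_tuple (enum_fset D) by []; exists j; rewrite /v -ij.
by rewrite innerBl co subrr.
Qed.

End Orthonormal.

(** * Orthonormal eigenvectors of a compact operator *)

Section Eigenbasis.
Context (R : realType) (k : scalar_kind) (H : hilbertSpace R k).
Notation K := (scalar_field R k).
Notation conj := (@conj_scalar R k).
Notation of_real := (@of_real R k).
Notation "''[' u , v ]" := (inner H u v).
Variable A : {linear H -> H}.
Hypothesis (cA : compact_operator A) (saA : self_adjoint A) (nnA : nonnegative A).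

Lemma eigenspaces_orth (mu nu : R) x y : mu != nu ->
  A x = of_real mu *: x -> A y = of_real nu *: y -> '[x, y] = 0.
Proof.
move=> mn Ax Ay; have := saA x y; rewrite Ax Ay innerZl innerZr conj_of_real => /eqP.
rewrite -subr_eq0 -mulrBl mulf_eq0 subr_eq0 (inj_eq (fmorph_inj _)) (negbTE mn) /=.
by move=> /eqP.
Qed.

(** Vectors [e n] with [lam n = 0] are arbitrary. The last clause expresses that the [e n] with
    [lam n = mu] exhaust the eigenspace of [mu]. *)
Definition eigenbasis (lam : nat -> R) (e : nat -> H) :=
  [/\ forall n, 0 < lam n -> A (e n) = of_real (lam n) *: e n,
      forall i j, 0 < lam i -> 0 < lam j -> '[e i, e j] = (i == j)%:R &
      forall mu x v, 0 < mu -> (forall n, lam n = mu -> '[x, e n] = 0) ->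
        A v = of_real mu *: v -> '[x, v] = 0].

(** The multiplicity of [mu] in the sequence is the dimension of its eigenspace, so the indices [n]
    with [lam n = mu] can be matched, by their position in the finite set they form, with a
    Gram-Schmidt basis. Vectors for different eigenvalues are orthogonal by self-adjointness. *)
Lemma eigenbasis_exists lam : is_eigenvalue_seq A lam -> exists e, eigenbasis lam e.
Proof.
move=> [_ lam0 lamP].
have /choice[E EP] : forall mu : R, exists e : nat -> H, 0 < mu ->
   [/\ forall n, lam n = mu -> A (e n) = of_real mu *: e n,
      forall i j, lam i = mu -> lam j = mu -> '[e i, e j] = (i == j)%:R &
      forall x v, (forall n, lam n = mu -> '[x, e n] = 0) ->
        A v = of_real mu *: v -> '[x, v] = 0].
  move=> mu; have [mu0|_] := boolP (0 < mu); last by exists (fun=> 0).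
  have [fin [v [fr Vv]]] := lamP mu mu0.
  set D := fset_set [set n | lam n = mu] in v fr Vv.
  have inD n : lam n = mu -> n \in D by move=> ln; rewrite in_fset_set// inE.
  have vmu i : A (v i) = of_real mu *: v i.
    have : op_eigenspace A mu (v i); last by [].
    rewrite Vv; exists (fun j => (j == i)%:R); rewrite (bigD1 i)//= eqxx scale1r big1 ?addr0// => j.
    by move=> /negbTE ->; rewrite scale0r.
  pose w n := if insub n is Some i then v i else 0.
  have wv (i : 'I_#|` D|) : w i = v i by rewrite /w valK.
  have [|u [ou su uv]] := @gram_schmidt _ _ _ w #|` D|.
    move=> c; under eq_bigr do rewrite wv.
    by move=> /(fr (fun i => c i)) c0 i id; exact: (c0 (Ordinal id)).
  pose idx n := index n (enum_fset D).
  have idxD n : lam n = mu -> (idx n < #|` D|)%N by move=> /inD; rewrite index_mem.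
  exists (fun n => u (idx n)) => _; split.
  - move=> n /idxD ln; have [c ->] := su _ ln.
    rewrite linear_sum scaler_sumr; apply: eq_bigr => j _.
    by rewrite linearZ /= wv vmu !scalerA mulrC.
  - move=> i j li lj; rewrite ou ?idxD//; congr ((_ : bool)%:R).
    apply/eqP/eqP => [|->//]; rewrite /idx => ij.
    by rewrite -(nth_index 0%N (inD _ li)) ij nth_index// inD.
  - move=> x z xu Az; have : op_eigenspace A mu z by [].
    rewrite Vv => -[c ->]; rewrite innerC inner_suml big1 ?rmorph0// => i _.
    rewrite innerZl -wv [inner _ _ _]inner_eq0C ?mulr0//; apply: uv => // j jd.
    have ln : lam (nth 0%N (enum_fset D) j) = mu.
      by have := mem_nth 0%N jd; rewrite in_fset_set// inE.
    by have := xu _ ln; rewrite /idx index_uniq ?fset_uniq.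
exists (fun n => E (lam n) n); split.
- by move=> n ln; have [+ _ _] := EP _ ln; apply.
- move=> i j li lj; have [Ei oi _] := EP _ li; have [Ej oj _] := EP _ lj.
  have [lij|lij] := eqVneq (lam i) (lam j); first by rewrite -lij oi.
  rewrite (eigenspaces_orth lij (Ei i erefl) (Ej j erefl)).
  by have [ij|//] := eqVneq i j; rewrite ij eqxx in lij.
- move=> mu x v mu0 xe; have [_ _] := EP _ mu0; apply => n ln.
  by have := xe n ln; rewrite ln.
Qed.

(* The component of [x] orthogonal to the finitely many eigenvectors above the
   level [d] is mapped by [A] to a vector of norm at most [d |x|]. *)
Lemma range_orth (lam : nat -> R) e (G : hilbertSpace R k) (T : {linear H -> G}) (B : R) z :
  0 <= B -> (forall x, rnorm (T x) <= B * rnorm x) -> eigenbasis lam e ->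
  (forall d, 0 < d -> finite_set [set n | d < lam n]) ->
  (forall n, 0 < lam n -> inner G (T (e n)) z = 0) ->
  forall x, inner G (T (A x)) z = 0.
Proof.
move=> B0 TB [Ae oe ev] fin Tz x.
apply/eqP; rewrite -normr_le0 -(real_part_geK (normr_ge0 _)).
rewrite -(rmorph0 of_real) of_real_le.
apply: (@ler0_eps _ _ (B * rnorm x * rnorm z)) => [|d d0].
  by rewrite !mulr_ge0 ?rnorm_ge0.
set D := fset_set [set n | d < lam n].
have inD n : (n \in D) = (d < lam n) by rewrite in_fset_set ?inE//; [exact/asboolP/idP|exact: fin].
have Dpos (n : D) : 0 < lam (val n) by rewrite (lt_trans d0)// -inD; exact: valP.
pose s := \sum_(n : D) '[x, e (val n)] *: e (val n).
have xs n : d < lam n -> '[x - s, e n] = 0.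
  move=> dn; have nD : n \in D by rewrite inD.
  rewrite innerBl inner_suml (bigD1 [` nD]%fset)//= big1 ?addr0; first by
    rewrite innerZl oe ?(lt_trans d0)// eqxx mulr1 subrr.
  move=> j; rewrite -(inj_eq val_inj) /= => jn.
  by rewrite innerZl oe ?(lt_trans d0 dn) ?Dpos// (negbTE jn) mulr0.
have h1 : rnorm (A (x - s)) <= d * rnorm (x - s).
  apply: rnorm_orth_eigen => //; first exact: ltW.
  move=> mu v dmu Av; apply: (ev mu) => //; first exact: lt_trans dmu.
  by move=> n ln; apply: xs; rewrite ln.
have h2 : rnorm (x - s) <= rnorm x.
  have [->|xs0] := eqVneq (x - s) 0; first by rewrite rnorm0 rnorm_ge0.
  have xsp : 0 < rnorm (x - s) by rewrite ltNge; apply/negP => /rnorm0_eq0 /eqP; apply/negP.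
  rewrite -(ler_pM2l xsp) -expr2 -(of_real_le k) rmorphXn rmorphM /= !of_rnorm -inner_norm.
  have xsx : inner H (x - s) (x - s) = '[x - s, x].
    rewrite innerBr [X in _ - X]innerC inner_suml big1 ?rmorph0 ?subr0// => n _.
    rewrite innerZl (inner_eq0C (xs _ _)) ?mulr0// -inD; exact: valP.
  have := norm_inner_le (x - s) x.
  by rewrite -xsx ger0_norm// inner_norm exprn_ge0.
have -> : inner G (T (A x)) z = inner G (T (A (x - s))) z.
  rewrite !linearB innerBl /= /s !linear_sum inner_suml /= big1 ?subr0// => n _.
  by rewrite (linearZ_LR A) (linearZ_LR T) /= Ae ?Dpos// (linearZ_LR T) /= !innerZl Tz ?Dpos// !mulr0.
rewrite -(of_real_le k) real_part_geK//.
apply: le_trans (norm_inner_le _ _) _; rewrite -!of_rnorm -rmorphM of_real_le.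
rewrite mulrAC ler_wpM2r ?rnorm_ge0// (le_trans (TB _))//.
rewrite -mulrA ler_wpM2l// (le_trans h1)// mulrC.
by rewrite ler_pM2r.
Qed.

End Eigenbasis.

(** * Eigenspaces of a tensor product *)

Section Tensor.
Context (R : realType) (k : scalar_kind) (H1 H2 : hilbertSpace R k)
  (HH : hilbertTensor H1 H2).
Notation of_real := (@of_real R k).
Notation "''[' u , v ]" := (inner HH u v).
Notation "x ** y" := (tens HH x y) (at level 40).

Definition elementary_sums : set HH :=
  [set z | exists (n : nat) (x : 'I_n -> H1) (y : 'I_n -> H2), z = \sum_(i < n) x i ** y i].

Lemma rnorm_tens x y : rnorm (x ** y) = rnorm x * rnorm y.
Proof.
apply: (@pexpIrn _ 2); rewrite ?nnegrE ?mulr_ge0 ?rnorm_ge0//.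
apply: (fmorph_inj of_real).
by rewrite rmorphXn exprMn rmorphM !rmorphXn /= !of_rnorm -!inner_norm inner_tens.
Qed.

Lemma elementary_sums_approx (A : {linear HH -> HH}) w (d : R) : continuous A -> 0 < d ->
  exists w', [/\ elementary_sums w', rnorm (w - w') <= d & rnorm (A w - A w') <= d].
Proof.
move=> contA d0; have d0' : 0 < of_real d.
  by rewrite lt_def -(rmorph0 of_real) of_real_le ltW// (inj_eq (fmorph_inj _)) gt_eqF.
have Nw : nbhs w (ball w (of_real d) `&` A @^-1` ball (A w) (of_real d)).
  apply: filterI; first exact: nbhsx_ballx.
  by apply: contA; exact: nbhsx_ballx.
have NI : interior (ball w (of_real d) `&` A @^-1` ball (A w) (of_real d)) !=set0.
  by exists w; exact: Nw.
have [w' [/interior_subset[wd Awd] w'D]] := tens_dense NI (@open_interior _ _).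
move: wd Awd; rewrite /= -!ball_normE /= => wd Awd.
by exists w'; split=> //; rewrite le_rnorm ltW.
Qed.

Variables (A1 : {linear H1 -> H1}) (A2 : {linear H2 -> H2}) (A : {linear HH -> HH}).
Hypothesis tensA : is_tensor_operator A1 A2 A.
Hypothesis (cA1 : compact_operator A1) (saA1 : self_adjoint A1) (nnA1 : nonnegative A1).
Hypothesis (cA2 : compact_operator A2) (saA2 : self_adjoint A2) (nnA2 : nonnegative A2).

(** For [w] a sum of elementary tensors this is self-adjointness of the factors; density and
    continuity of [A] carry it to every [w]. *)
Lemma tensor_self_adjoint x y w : '[A (x ** y), w] = '[x ** y, A w].
Proof.
have [contA Atens] := tensA.
apply/eqP; rewrite -subr_eq0 -normr_le0 -(real_part_geK (normr_ge0 _)).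
rewrite -(rmorph0 of_real) of_real_le.
apply: (@ler0_eps _ _ (rnorm (A (x ** y)) + rnorm (x ** y))) => [|d d0].
  by rewrite addr_ge0 ?rnorm_ge0.
have [w' [[n [u [v ->]]]]] := elementary_sums_approx w contA d0.
set w'' := \sum_(_ < _) _ => h1 h2.
have e : '[A (x ** y), w''] = '[x ** y, A w''].
  rewrite /w'' (linear_sum A) [LHS]innerC [RHS]innerC !inner_suml; congr (conj_scalar _).
  apply: eq_bigr => i _; rewrite !Atens !inner_tens.
  by rewrite saA1 saA2.
have -> : '[A (x ** y), w] - '[x ** y, A w] =
   '[A (x ** y), w - w''] - '[x ** y, A w - A w''].
  by rewrite !innerBr e opprB addrA subrK.
rewrite -(of_real_le k) real_part_geK// mulrDl rmorphD !rmorphM /=.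
rewrite (le_trans (ler_normB _ _))// lerD// (le_trans (norm_inner_le _ _))// !of_rnorm ler_wpM2l//.
  by rewrite -of_rnorm of_real_le.
by rewrite -of_rnorm of_real_le.
Qed.

Lemma elementary_orth_eq0 z : continuous A -> (forall x y, '[x ** y, z] = 0) -> z = 0.
Proof.
move=> contA h; apply: rnorm0_eq0; apply: (@ler0_eps _ _ 1) => // d d0.
have [w' [[n [u [v ->]]]]] := elementary_sums_approx z contA d0.
set w := \sum_(_ < _) _ => h1 _; rewrite mul1r.
have [->|z0] := eqVneq z 0; first by rewrite rnorm0 ltW.
have zp : 0 < rnorm z by rewrite ltNge; apply/negP => /rnorm0_eq0 /eqP; apply/negP.
apply: le_trans h1; rewrite -(ler_pM2r zp) -(of_real_le k) !rmorphM /= !of_rnorm.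
have -> : `|z| * `|z| = '[z - w, z].
  by rewrite innerBl inner_norm expr2 /w inner_suml big1 ?subr0// => i _; exact: h.
apply: le_trans (norm_inner_le _ _); rewrite ger0_norm//.
by rewrite innerBl /w inner_suml big1 ?subr0 ?inner_norm ?exprn_ge0// => i _; exact: h.
Qed.

Variables (lam1 lam2 : nat -> R) (e1 : nat -> H1) (e2 : nat -> H2).
Hypothesis (b1 : eigenbasis A1 lam1 e1) (b2 : eigenbasis A2 lam2 e2).
Hypothesis (lam1_ge0 : forall n, 0 <= lam1 n) (lam2_ge0 : forall n, 0 <= lam2 n).
Hypothesis (fin1 : forall d, 0 < d -> finite_set [set n | d < lam1 n]).
Hypothesis (fin2 : forall d, 0 < d -> finite_set [set n | d < lam2 n]).

(* An eigenvector for [mu] orthogonal to all products of eigenvectors is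
   orthogonal to [A1 x ** A2 y = A (x ** y)], hence to every [x ** y]. *)
Lemma tensor_eigenspace_dim mu (mu0 : 0 < mu) :
  finite_set [set ij : nat * nat | lam1 ij.1 * lam2 ij.2 = mu] ->
  has_dim (op_eigenspace A mu)
    #|` fset_set [set ij : nat * nat | lam1 ij.1 * lam2 ij.2 = mu] |.
Proof.
move=> fin; set D := fset_set _; have [contA Atens] := tensA.
have [Ae1 oe1 _] := b1; have [Ae2 oe2 _] := b2.
have DP ij : ij \in D -> [/\ 0 < lam1 ij.1, 0 < lam2 ij.2 & lam1 ij.1 * lam2 ij.2 = mu].
  rewrite in_fset_set// inE /= => e; split=> //.
    by rewrite lt_def lam1_ge0 andbT; apply: contraTneq mu0 => l; rewrite -e l mul0r ltxx.
  by rewrite lt_def lam2_ge0 andbT; apply: contraTneq mu0 => l; rewrite -e l mulr0 ltxx.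
have Ag i j : 0 < lam1 i -> 0 < lam2 j ->
    A (e1 i ** e2 j) = of_real (lam1 i * lam2 j) *: (e1 i ** e2 j).
  by move=> li lj; rewrite Atens Ae1// Ae2// linearZl_LR linearZr_LR scalerA rmorphM.
apply: (@has_dim_orthonormal _ _ _ _ D (fun ij => e1 ij.1 ** e2 ij.2)).
- move=> [i j] [i' j'] /DP[/= l1 l2 _] /DP[/= l1' l2' _].
  by rewrite inner_tens oe1// oe2// -natrM mulnb.
- by move=> [i j] /DP[/= l1 l2 e]; rewrite /op_eigenspace /= Ag// e.
- move=> a x y; rewrite /op_eigenspace /= => Ax Ay.
  by rewrite linearP Ax Ay scalerDr !scalerA mulrC.
- by rewrite /op_eigenspace /= linear0 scaler0.
move=> z; rewrite /op_eigenspace /= => Az zD.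
(* Products with eigenvalue [mu] are covered by [zD]; the others belong to a different eigenvalue
   than [z]. *)
have ge i j : 0 < lam1 i -> 0 < lam2 j -> '[e1 i ** e2 j, z] = 0.
  move=> li lj; have [e|ne] := eqVneq (lam1 i * lam2 j) mu.
    by apply: inner_eq0C; apply: (zD (i, j)); rewrite in_fset_set// inE.
  have := tensor_self_adjoint (e1 i) (e2 j) z; rewrite Ag// Az innerZl innerZr conj_of_real => /eqP.
  rewrite -subr_eq0 -mulrBl mulf_eq0 subr_eq0 (inj_eq (fmorph_inj _)) (negbTE ne) /=.
  by move=> /eqP.
(* One variable at a time: [range_orth] is applied to [x] tensored with the fixed vector [e2 j],
   then to [A1 x] tensored with a variable [y]. *)
have h1 j x : 0 < lam2 j -> '[A1 x ** e2 j, z] = 0.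
  move=> lj; have := @range_orth _ _ _ _ cA1 saA1 nnA1 _ _ HH (applyr (tens HH) (e2 j)) (rnorm (e2 j)) z _ _ b1 fin1.
  by apply=> //; [exact: rnorm_ge0|move=> u; rewrite /= rnorm_tens mulrC|move=> i li; exact: ge].
have h2 x y : '[A1 x ** A2 y, z] = 0.
  have := @range_orth _ _ _ _ cA2 saA2 nnA2 _ _ HH (tens HH (A1 x)) (rnorm (A1 x)) z _ _ b2 fin2.
  by apply=> //; [exact: rnorm_ge0|move=> u; rewrite /= rnorm_tens|move=> j lj; exact: h1].
apply: (elementary_orth_eq0 contA) => x y.
have := tensor_self_adjoint x y z; rewrite Az Atens h2 innerZr conj_of_real.
move=> /esym/eqP; rewrite mulf_eq0 fmorph_eq0 gt_eqF//= => /eqP //.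
Qed.

End Tensor.

(** * Counting and rearrangement *)

Section Counting.
Context (R : realType).

Lemma card_fset_set_seq (I : choiceType) (X : set I) (s : seq I) :
  uniq s -> (forall x, X x <-> x \in s) -> finite_set X /\ #|` fset_set X| = size s.
Proof.
move=> us Xs; have XE : X = [set` s] by apply/seteqP; split=> x /Xs.
have fX : finite_set X by rewrite XE; exact: finite_seq.
split=> //; apply: perm_size; apply: uniq_perm => // x.
rewrite [LHS]in_fset_set//; apply/idP/idP => [|xs]; last by apply/mem_set/Xs.
by rewrite inE => /Xs.
Qed.

Lemma card_fset_set_le (I : choiceType) (X Y : set I) :
  finite_set Y -> X `<=` Y -> (#|` fset_set X| <= #|` fset_set Y|)%N.
Proof.
move=> fY XY; apply: fsubset_leq_card; rewrite -fset_set_sub//.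
exact: sub_finite_set fY.
Qed.

Lemma seq_gap_below (q : seq R) (a m : R) : a < m ->
  exists2 s, a <= s < m & forall x, x \in q -> x < m -> x <= s.
Proof.
elim: q a => [|y q IH] a am; first by exists a => //; rewrite lexx.
have [ym|my] := ltP y m; last first.
  have [s asm sP] := IH a am; exists s => // x; rewrite inE => /predU1P[->|]; last exact: sP.
  by rewrite ltNge my.
have [s /andP[as_ sm] sP] := IH (Num.max a y) ltac:(by rewrite gt_max am).
move: as_; rewrite ge_max => /andP[as_ ys].
by exists s; rewrite ?as_// => x; rewrite inE => /predU1P[->//|]; exact: sP.
Qed.

Lemma seq_gap_above (q : seq R) (t : R) :
  exists2 t', t < t' & forall x, x \in q -> t < x -> t' < x.
Proof.
elim: q => [|y q [t' tt' t'P]]; first by exists (t + 1) => //; rewrite ltrDl.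
have [ty|yt] := ltP t y; last first.
  by exists t' => // x; rewrite inE => /predU1P[->|]; [rewrite ltNge yt|exact: t'P].
exists (Num.min t' ((t + y) / 2)); first by rewrite lt_min tt' midf_lt.
move=> x; rewrite inE gt_min => /predU1P[-> _|xq tx]; last by rewrite t'P.
by rewrite [X in _ || X](midf_lt ty) orbT.
Qed.

Lemma seq_bound (q : seq R) : exists2 b, 0 < b & forall x, x \in q -> x <= b.
Proof.
elim: q => [|y q [b b0 bP]]; first by exists 1.
exists (Num.max b y); first by rewrite lt_max b0.
by move=> x; rewrite inE le_max => /predU1P[->|/bP ->//]; rewrite lexx orbT.
Qed.

Lemma mem_fset_setb (I : choiceType) (P : pred I) i :
  finite_set [set i | P i] -> (i \in fset_set [set i | P i]) = P i.
Proof. by move=> fin; rewrite in_fset_set//; apply/idP/idP; rewrite inE. Qed.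

Lemma card_superlevel (I : choiceType) (u : I -> R) (t : R) (V : seq R) :
  uniq V -> finite_set [set i | t < u i] ->
  (forall i, t < u i -> u i \in V) -> (forall m, m \in V -> t < m) ->
  #|` fset_set [set i | t < u i]| = (\sum_(m <- V) #|` fset_set [set i | u i = m]|)%N.
Proof.
move=> uV fin uiV tV; set F := fset_set _.
have inF i : (i \in F) = (t < u i) by exact: mem_fset_setb.
rewrite -sum1_size (eq_big_seq (fun i => \sum_(m <- V) (u i == m))%N); last first.
  move=> i; rewrite inF => /uiV iV.
  rewrite (bigD1_seq (u i))//= eqxx big1// => m /negbTE.
  by rewrite eq_sym => ->.
rewrite exchange_big; apply: eq_big_seq => m mV /=.
transitivity (\sum_(i <- F | u i == m) 1)%N.
  by rewrite [RHS]big_mkcond; apply: eq_bigr => i _; case: eqP.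
rewrite sum1_count -size_filter.
have uF : uniq [seq i <- F | u i == m] by rewrite filter_uniq.
have [|_ ->//] := @card_fset_set_seq _ [set i | u i = m] _ uF.
move=> i; rewrite mem_filter inF /=; split=> [im|/andP[/eqP]//].
by rewrite im eqxx tV.
Qed.

(** Counts above a positive level depend only on the multiplicities. Finiteness on the side of [u]
    also comes from them: a value of [u] has positive multiplicity, hence is one of the finitely
    many values of [v] above [t]. *)
Lemma card_superlevel_eq (I J : choiceType) (u : I -> R) (v : J -> R) (t : R) :
  0 < t -> finite_set [set j | t < v j] ->
  (forall m, 0 < m -> finite_set [set i | u i = m] /\
    #|` fset_set [set i | u i = m]| = #|` fset_set [set j | v j = m]|) ->
  finite_set [set i | t < u i] /\
  #|` fset_set [set i | t < u i]| = #|` fset_set [set j | t < v j]|.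
Proof.
move=> t0 fin uv; set F := fset_set [set j | t < v j].
have inF j : (j \in F) = (t < v j) by exact: mem_fset_setb.
pose V := undup [seq v j | j <- F].
have tV m : m \in V -> t < m by rewrite mem_undup => /mapP[j]; rewrite inF => tj ->.
have vV j : t < v j -> v j \in V by move=> tj; rewrite mem_undup map_f// inF.
have fv m : t < m -> finite_set [set j | v j = m].
  by move=> tm; apply: sub_finite_set fin => j /= ->.
have uV i : t < u i -> u i \in V.
  move=> ti; have [fu] := uv _ (lt_trans t0 ti).
  set F' := fset_set [set j | v j = u i] => e.
  have : (0 < #|` F'|)%N.
    rewrite -e cardfs_gt0; apply/fset0Pn; exists i.
    by rewrite in_fset_set// inE.
  rewrite cardfs_gt0 => /fset0Pn[j]; rewrite in_fset_set; last exact: fv.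
  by rewrite inE /= => ji; rewrite -ji vV// ji.
have finu : finite_set [set i | t < u i].
  apply: (@sub_finite_set _ _ (\bigcup_(m in [set` V]) [set i | u i = m])).
    by move=> i /= /uV iV; exists (u i).
  apply: bigcup_finite => [|m /= /tV tm]; first exact: finite_seq.
  by have [] := uv _ (lt_trans t0 tm).
split=> //; rewrite (card_superlevel (undup_uniq _) finu uV tV) (card_superlevel (undup_uniq _) fin vV tV).
by apply: eq_big_seq => m /tV tm; have [] := uv _ (lt_trans t0 tm).
Qed.

(** [l] is the generalized inverse of the counting function [N] of [v], characterized by [t < l n]
    if and only if [n < N t]. *)
Lemma rearrangement (I : choiceType) (v : I -> R) :
  (forall t, 0 < t -> finite_set [set i | t < v i]) ->
  exists l : nat -> R, [/\ nonincreasing_seq l, forall n, 0 <= l n &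
    forall m, 0 < m -> finite_set [set n | l n = m] /\
      #|` fset_set [set n | l n = m]| = #|` fset_set [set i | v i = m]| ].
Proof.
move=> fin; pose N t := #|` fset_set [set i | t < v i]|.
have NE s t : 0 < s -> 0 < t -> (forall i, (s < v i) = (t < v i)) -> N s = N t.
  by move=> s0 t0 st; rewrite /N; congr (#|` fset_set _|); apply/seteqP; split=> i /=; rewrite st.
have Nle s t : 0 < s -> s <= t -> (N t <= N s)%N.
  move=> s0 st; apply: card_fset_set_le; first exact: fin.
  by move=> i /=; exact: le_lt_trans.
pose E n := [set t | 0 < t /\ (N t <= n)%N].
pose l n := inf (E n).
have E0 n : E n !=set0.
  have [b b0 bP] := seq_bound [seq v i | i <- fset_set [set i | 1 < v i]].
  pose c := Num.max 1 b; have c0 : 0 < c by rewrite lt_max ltr01.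
  exists c; split=> //; rewrite (_ : N c = 0%N)// /N.
  rewrite (_ : [set i | c < v i] = set0) ?fset_set0// -subset0 => i /=.
  rewrite gt_max => /andP[v1 vb]; suff : v i <= b by rewrite leNgt vb.
  by apply: bP; apply: map_f; rewrite mem_fset_setb//; exact: fin.
have El n : lbound (E n) 0 by move=> t [/ltW].
have infE n : has_inf (E n) by split=> //; exists 0.
(* For [n < N t] the strict inequality needs room: no value of [v] lies in []t, t']], so [N] keeps
   its value up to [t'] and the infimum is at least [t']. *)
have ltl t n : 0 < t -> (t < l n) = (n < N t)%N.
  move=> t0; apply/idP/idP => [tl|nN].
    rewrite ltnNge; apply/negP => Nn.
    by have := ge_inf (infE n).2 (conj t0 Nn); rewrite leNgt tl.
  have [t' tt' t'P] := seq_gap_above [seq v i | i <- fset_set [set i | t < v i]] t.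
  apply: lt_le_trans tt' _; apply: lb_le_inf => // s [s0 Ns].
  rewrite leNgt; apply/negP => st'; move: nN; apply/negP; rewrite -leqNgt.
  apply: leq_trans Ns; have -> : N t = N (Num.max s t).
    apply: NE => //; first by rewrite lt_max t0 orbT.
    move=> i; apply/idP/idP => [ti|]; last by rewrite gt_max => /andP[].
    rewrite gt_max ti andbT; apply: lt_trans st' _; apply: t'P => //.
    by apply: map_f; rewrite mem_fset_setb//; exact: fin.
  by apply: Nle => //; rewrite le_max lexx.
have l0 n : 0 <= l n by exact: lb_le_inf.
exists l; split=> //.
  move=> n p np; rewrite leNgt; apply/negP => lnp.
  have t0 : 0 < (l n + l p) / 2 by have := l0 n; lra.
  have := ltl _ p t0; rewrite (_ : _ < l p) => [|]; last by lra.
  move=> /esym pN; have := leq_ltn_trans np pN; rewrite -ltl//.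
  by move=> ?; lra.
move=> m m0.
have m20 : 0 < m / 2 by rewrite divr_gt0.
(* No value of [v] lies strictly between [s] and [m]. Hence [N s] exceeds [N m] by the multiplicity
   of [m], and the indices with [l n = m] form the interval from [N m] to [N s]. *)
have [|s /andP[ms sm] sP] := @seq_gap_below [seq v i | i <- fset_set [set i | m / 2 < v i]] (m / 2) m; first by lra.
have s0 : 0 < s by exact: lt_le_trans ms.
have sv i : s < v i -> m <= v i.
  move=> si; rewrite leNgt; apply/negP => im; suff : v i <= s by rewrite leNgt si.
  apply: sP => //; apply: map_f; rewrite mem_fset_setb; last exact: fin.
  exact: le_lt_trans si.
have lmE n : l n = m <-> (N m <= n < N s)%N.
  rewrite leqNgt -!ltl//; split=> [->|/andP[]]; first by rewrite ltxx sm.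
  rewrite -leNgt le_eqVlt => /predU1P[//|lm sl].
  have ln0 : 0 < l n by exact: lt_trans sl.
  have := ltl (l n) n ln0; rewrite ltxx => /esym/negbT.
  rewrite (NE (l n) s)//; last first.
    move=> i; apply/idP/idP => [|/sv mi]; first exact: lt_trans.
    exact: lt_le_trans mi.
  by rewrite -ltl// sl.
have [|fl cl] := @card_fset_set_seq _ [set n | l n = m] (iota (N m) (N s - N m)) (iota_uniq _ _).
  move=> n /=; rewrite mem_iota subnKC; first exact: lmE.
  by apply: Nle => //; exact: ltW.
split=> //; rewrite cl size_iota.
have fvm : finite_set [set i | v i = m].
  by apply: sub_finite_set (fin _ m20) => i /= ->; lra.
have -> : N s = (N m + #|` fset_set [set i | v i = m]|)%N.
  rewrite /N -cardfsUI; rewrite -fset_setU -?fset_setI//; try exact: fin.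
  rewrite (_ : _ `&` _ = set0) ?fset_set0 ?cardfs0 ?addn0.
    congr (#|` fset_set _|); apply/seteqP; split=> i /= .
      by move=> /sv; rewrite le_eqVlt => /predU1P[->|]; [right|left].
    by move=> [|->//]; exact: lt_trans.
  by rewrite -subset0 => i /= [+ im]; rewrite im ltxx.
by rewrite addKn.
Qed.

End Counting.

(** * Counting pairs by cells *)

Section ProductCounting.
Context (R : realType).

Definition ncard (I : choiceType) (X : set I) : R := #|` fset_set X|%:R.

Lemma ncard_le (I : choiceType) (X Y : set I) :
  finite_set Y -> X `<=` Y -> ncard X <= ncard Y.
Proof. by move=> fY XY; rewrite ler_nat card_fset_set_le. Qed.

Lemma ncardX (I J : choiceType) (X : set I) (Y : set J) :
  finite_set X -> finite_set Y -> ncard (X `*` Y) = ncard X * ncard Y.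
Proof.
move=> fX fY; have [||_ e] := @card_fset_set_seq _ (X `*` Y)
  [seq (i, j) | i <- fset_set X, j <- fset_set Y].
- by apply: allpairs_uniq; rewrite ?fset_uniq// => -[? ?] [? ?].
- move=> [i j] /=; split=> [[Xi Yj]|/allpairsP[[i' j'] /= [+ + [-> ->]]]].
    by apply/allpairsP; exists (i, j); split=> //=; rewrite in_fset_set// inE.
  by rewrite !in_fset_set// !inE.
by rewrite /ncard e size_allpairs natrM.
Qed.

Lemma ncard_setD (I : choiceType) (X Y : set I) : finite_set Y -> X `<=` Y ->
  ncard Y = ncard X + ncard (Y `\` X).
Proof.
move=> fY XY; have fX := sub_finite_set XY fY.
rewrite /ncard -natrD fset_setD// cardfsD; congr (_%:R).
have /fsetIidPr -> : (fset_set X `<=` fset_set Y)%fset by rewrite -fset_set_sub.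
by rewrite subnKC// card_fset_set_le.
Qed.

Variables (lam1 lam2 : nat -> R) (b : R).
Hypothesis (lam1_ge0 : forall n, 0 <= lam1 n) (lam2_ge0 : forall n, 0 <= lam2 n).
Hypothesis (fin1 : forall d, 0 < d -> finite_set [set n | d < lam1 n]).
Hypothesis (fin2 : forall d, 0 < d -> finite_set [set n | d < lam2 n]).
Hypothesis (lam1_le : forall n, lam1 n <= expR b) (lam2_le : forall n, lam2 n <= expR b).

Let A1 x := ncard [set n | expR (- x) < lam1 n].
Let A2 x := ncard [set n | expR (- x) < lam2 n].
Let X x := [set ij : nat * nat | expR (- x) < lam1 ij.1 * lam2 ij.2].

(** The other factor is at most [expR b]. This makes the set of pairs finite and is the origin of
    the argument [x + b] in the edge terms. *)
Let X_sub x : X x `<=` [set i | expR (- (x + b)) < lam1 i] `*` [set j | expR (- (x + b)) < lam2 j].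
Proof.
move=> [i j]; rewrite /X /= opprD expRD => h.
split; rewrite /= -(ltr_pM2r (expR_gt0 b)) -mulrA -expRD addNr expR0 mulr1;
  apply: lt_le_trans h _; first by rewrite ler_wpM2l.
by rewrite mulrC ler_wpM2l.
Qed.

Lemma finite_product_superlevel x : finite_set (X x).
Proof.
apply: sub_finite_set (@X_sub x) _; apply: finite_setX; [apply: fin1|apply: fin2]; exact: expR_gt0.
Qed.

Let Y x s := [set ij : nat * nat | expR (- s) < lam1 ij.1] `&` X x.

Let fY x s : finite_set (Y x s).
Proof. by apply: sub_finite_set (finite_product_superlevel x) => ij []. Qed.

Let f1 x : finite_set [set n | expR (- x) < lam1 n].
Proof. by apply: fin1; exact: expR_gt0. Qed.
Let f2 x : finite_set [set n | expR (- x) < lam2 n].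
Proof. by apply: fin2; exact: expR_gt0. Qed.

Let Ymono x s t : s <= t -> Y x s `<=` Y x t.
Proof.
move=> st ij [/= h ?]; split=> //=; apply: le_lt_trans h.
by rewrite ler_expR lerN2.
Qed.

Let lam1_mono s t : s <= t ->
  [set n | expR (- s) < lam1 n] `<=` [set n | expR (- t) < lam1 n].
Proof. by move=> st n /=; apply: le_lt_trans; rewrite ler_expR lerN2. Qed.

Let expR_split (x s : R) : expR (- x) = expR (- s) * expR (- (x - s)).
Proof. by rewrite -expRD -opprD subrKC. Qed.

(** A pair of the cell has [lam1 <= expR (- s)], which forces [expR (- (x - s)) < lam2]. The lower
    bound [Ystep_ge] uses [expR (- t) < lam1] at the other end. *)
Let Ystep_le x s t : s <= t ->
  ncard (Y x t) - ncard (Y x s) <= (A1 t - A1 s) * A2 (x - s).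
Proof.
move=> st; rewrite (ncard_setD (fY x t) (Ymono st)) addrAC subrr add0r.
rewrite /A1 (ncard_setD (f1 t) (lam1_mono st)) addrAC subrr add0r.
rewrite -ncardX//; last exact: finite_setD.
apply: ncard_le; first by apply: finite_setX => //; exact: finite_setD.
move=> [i j] [[/= ti h] /not_andP]; rewrite /= -/(X x (i, j)) => -[|//] si.
split; first by split.
move: h; rewrite /X /= (expR_split x s) => h.
rewrite -(ltr_pM2l (expR_gt0 (- s))); apply: lt_le_trans h _.
by rewrite ler_wpM2r// leNgt; exact/negP.
Qed.

Let Ystep_ge x s t : s <= t ->
  (A1 t - A1 s) * A2 (x - t) <= ncard (Y x t) - ncard (Y x s).
Proof.
move=> st; rewrite (ncard_setD (fY x t) (Ymono st)) addrAC subrr add0r.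
rewrite /A1 (ncard_setD (f1 t) (lam1_mono st)) addrAC subrr add0r.
rewrite -ncardX//; last exact: finite_setD.
apply: ncard_le; first exact: finite_setD.
move=> [i j] [/= [ti si] tj]; split; last by move=> [].
split=> //; rewrite /X /= (expR_split x t).
by rewrite ltr_pM// ?expR_ge0.
Qed.

(* The first two terms bound the pairs with [lam1] large and those with [lam1]
   small (where [lam2] is large); the sum runs over the cells between them. *)
Lemma product_count_le x z h n : 0 <= h ->
  ncard (X x) <= A1 z * A2 (x + b) + A1 (x + b) * A2 (x - (z + n%:R * h)) +
    \sum_(r < n) (A1 (z + r.+1%:R * h) - A1 (z + r%:R * h)) * A2 (x - (z + r%:R * h)).
Proof.
move=> h0.
have e0 : ncard (Y x z) <= A1 z * A2 (x + b).
  rewrite -ncardX//; apply: ncard_le; first exact: finite_setX.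
  by move=> [i j] [/= ? /X_sub[]].
have e1 : ncard (X x) - ncard (Y x (z + n%:R * h)) <= A1 (x + b) * A2 (x - (z + n%:R * h)).
  rewrite (ncard_setD (finite_product_superlevel x) (_ : Y x (z + n%:R * h) `<=` X x)); last by move=> ? [].
  rewrite addrAC subrr add0r -ncardX//; apply: ncard_le; first exact: finite_setX.
  move=> [i j] [Xij /not_andP[/= si|//]]; have [? _] := X_sub Xij; split=> //=.
  set s := z + _ in si *.
  move: Xij; rewrite /X /= (expR_split x s) => hh.
  rewrite -(ltr_pM2l (expR_gt0 (- s))); apply: lt_le_trans hh _.
  by rewrite ler_wpM2r// leNgt; exact/negP.
have e2 : ncard (Y x (z + n%:R * h)) - ncard (Y x z) <=
    \sum_(r < n) (A1 (z + r.+1%:R * h) - A1 (z + r%:R * h)) * A2 (x - (z + r%:R * h)).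
  elim: n {e1} => [|n IH]; first by rewrite big_ord0 mul0r addr0 subrr.
  have st : z + n%:R * h <= z + n.+1%:R * h by rewrite lerD2l ler_wpM2r// ler_nat.
  rewrite big_ord_recr /= -(subrK (ncard (Y x (z + n%:R * h))) (ncard (Y x (z + n.+1%:R * h)))).
  by rewrite -addrA addrC lerD// Ystep_le.
rewrite lerBlDr in e1; apply: le_trans e1 _; rewrite lerBlDr in e2.
by rewrite [X in _ <= X + _]addrC -[X in _ <= X]addrA lerD2l addrC (le_trans e2)// lerD2l.
Qed.

(** Pairs outside the cells are dropped, so no edge terms occur. *)
Lemma product_count_ge x z h n : 0 <= h ->
  \sum_(r < n) (A1 (z + r.+1%:R * h) - A1 (z + r%:R * h)) * A2 (x - (z + r.+1%:R * h))
    <= ncard (X x).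
Proof.
move=> h0.
have e1 : ncard (Y x (z + n%:R * h)) <= ncard (X x).
  by apply: ncard_le; [exact: finite_product_superlevel|move=> ? []].
have e2 : \sum_(r < n) (A1 (z + r.+1%:R * h) - A1 (z + r%:R * h)) * A2 (x - (z + r.+1%:R * h))
    <= ncard (Y x (z + n%:R * h)) - ncard (Y x z).
  elim: n {e1} => [|n IH]; first by rewrite big_ord0 mul0r addr0 subrr.
  have st : z + n%:R * h <= z + n.+1%:R * h by rewrite lerD2l ler_wpM2r// ler_nat.
  rewrite big_ord_recr /= -(subrK (ncard (Y x (z + n%:R * h))) (ncard (Y x (z + n.+1%:R * h)))).
  by rewrite -addrA addrC lerD// Ystep_ge.
by apply: le_trans e2 _; rewrite lerBlDr (le_trans e1)// lerDl ler0n.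
Qed.

End ProductCounting.

(** * Counting function of the tensor product *)

Section CountingFunction.
Context (R : realType) (k : scalar_kind).

Section OneOperator.
Context (H : hilbertSpace R k) (A : {linear H -> H}).
Hypothesis pos : forall d, 0 < d -> exists2 t : R, 0 < t < d & counting_function t A != 0.

(** The dummy sequence 0 has counting function 0, so one nonzero count at a positive level shows
    that a genuine sequence was chosen. *)
Lemma op_eigenvalue_seq : is_eigenvalue_seq A (op_eigenvalue A).
Proof.
rewrite /op_eigenvalue; case: xgetP => [l -> //|noseq].
have [t /andP[t0 _]] := pos ltr01.
rewrite /counting_function /op_eigenvalue xgetPN; last by move=> l; exact: noseq.
rewrite (_ : [set _ | _] = set0) ?fset_set0 ?cardfs0 ?eqxx//.
by rewrite -subset0 => n /=; rewrite ltNge ltW.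
Qed.

(** [fset_set] of an infinite set is empty; a nonzero count at a level below [d] is therefore a
    proof of finiteness. *)
Lemma op_eigenvalue_finite d : 0 < d -> finite_set [set n | d < op_eigenvalue A n].
Proof.
move=> d0; have [t /andP[t0 td]] := pos d0; rewrite /counting_function.
set X := [set n | t < _] => cX.
suff fX : finite_set X by apply: sub_finite_set fX => n /=; exact: lt_trans.
apply: contrapT => nX; move: cX; rewrite /fset_set.
case: pselect => //=; rewrite ?eqxx//.
Qed.

Lemma op_eigenvalue_bound : exists b, forall n, op_eigenvalue A n <= expR b.
Proof.
have [mono l0 _] := op_eigenvalue_seq.
exists (op_eigenvalue A 0%N) => n; apply: le_trans (mono 0%N n _) _ => //.
by apply: le_trans (expR_ge1Dx _); rewrite lerDr.
Qed.

End OneOperator.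

(** The rearranged products form an eigenvalue sequence of [A], so the chosen one is genuine. Its
    multiplicities are dimensions of eigenspaces, hence agree with those of the products, and so do
    the counts. *)
Lemma counting_function_tensor (H1 H2 : hilbertSpace R k) (HH : hilbertTensor H1 H2)
    (A1 : {linear H1 -> H1}) (A2 : {linear H2 -> H2}) (A : {linear HH -> HH}) :
  compact_operator A1 -> self_adjoint A1 -> nonnegative A1 ->
  compact_operator A2 -> self_adjoint A2 -> nonnegative A2 ->
  is_tensor_operator A1 A2 A ->
  (forall d, 0 < d -> exists2 t : R, 0 < t < d & counting_function t A1 != 0) ->
  (forall d, 0 < d -> exists2 t : R, 0 < t < d & counting_function t A2 != 0) ->
  forall t, 0 < t -> counting_function t A =
    ncard R [set ij : nat * nat | t < op_eigenvalue A1 ij.1 * op_eigenvalue A2 ij.2].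
Proof.
move=> cA1 saA1 nnA1 cA2 saA2 nnA2 tensA pos1 pos2.
set lam1 := op_eigenvalue A1; set lam2 := op_eigenvalue A2.
have seq1 := op_eigenvalue_seq pos1; have seq2 := op_eigenvalue_seq pos2.
have [e1 b1] := eigenbasis_exists saA1 seq1.
have [e2 b2] := eigenbasis_exists saA2 seq2.
have fin1 := op_eigenvalue_finite pos1; have fin2 := op_eigenvalue_finite pos2.
have [[_ l1 _] [_ l2 _]] := (seq1, seq2).
have [c1 c1P] := op_eigenvalue_bound pos1; have [c2 c2P] := op_eigenvalue_bound pos2.
pose v (ij : nat * nat) := lam1 ij.1 * lam2 ij.2.
have finv d : 0 < d -> finite_set [set ij | d < v ij].
  move=> d0; have := @finite_product_superlevel _ lam1 lam2 (Num.max c1 c2) l1 l2 fin1 fin2.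
  rewrite -(lnK d0) -[ln d]opprK; apply => n.
    by apply: le_trans (c1P n) _; rewrite ler_expR le_max lexx.
  by apply: le_trans (c2P n) _; rewrite ler_expR le_max lexx orbT.
have finE m : 0 < m -> finite_set [set ij | v ij = m].
  by move=> m0; apply: sub_finite_set (finv (m / 2) _) => [ij /= ->|]; lra.
have dimE m (m0 : 0 < m) := tensor_eigenspace_dim tensA cA1 saA1 nnA1 cA2 saA2 nnA2
  b1 b2 l1 l2 fin1 fin2 m0 (finE m m0).
have [l [lmono l0 lP]] := rearrangement finv.
have seqA : is_eigenvalue_seq A (op_eigenvalue A).
  apply: (@xgetPex _ _ [set lam | is_eigenvalue_seq A lam]); exists l; split=> // m m0.
  by have [fm ->] := lP m m0; split=> //; exact: dimE.
have [_ _ A_P] := seqA.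
move=> t t0; rewrite /counting_function /ncard.
have [|_ ->//] := @card_superlevel_eq _ _ _ (op_eigenvalue A) v t t0 (finv t t0).
by move=> m m0; have [fm dm] := A_P m m0; split=> //; exact: has_dim_unique dm (dimE m m0).
Qed.

Lemma counting_function_tensor_bounds (H1 H2 : hilbertSpace R k) (HH : hilbertTensor H1 H2)
    (A1 : {linear H1 -> H1}) (A2 : {linear H2 -> H2}) (A : {linear HH -> HH}) :
  compact_operator A1 -> self_adjoint A1 -> nonnegative A1 ->
  compact_operator A2 -> self_adjoint A2 -> nonnegative A2 ->
  is_tensor_operator A1 A2 A ->
  (forall d, 0 < d -> exists2 t : R, 0 < t < d & counting_function t A1 != 0) ->
  (forall d, 0 < d -> exists2 t : R, 0 < t < d & counting_function t A2 != 0) ->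
  let N1 x := counting_function (expR (- x)) A1 in
  let N2 x := counting_function (expR (- x)) A2 in
  exists b, forall x z h n, 0 <= h ->
    counting_function (expR (- x)) A <=
      N1 z * N2 (x + b) + N1 (x + b) * N2 (x - (z + n%:R * h)) +
      \sum_(r < n) (N1 (z + r.+1%:R * h) - N1 (z + r%:R * h)) * N2 (x - (z + r%:R * h)) /\
    \sum_(r < n) (N1 (z + r.+1%:R * h) - N1 (z + r%:R * h)) * N2 (x - (z + r.+1%:R * h))
      <= counting_function (expR (- x)) A.
Proof.
move=> cA1 saA1 nnA1 cA2 saA2 nnA2 tensA pos1 pos2 N1 N2.
have fin1 := op_eigenvalue_finite pos1; have fin2 := op_eigenvalue_finite pos2.
have [[_ l1 _] [_ l2 _]] := (op_eigenvalue_seq pos1, op_eigenvalue_seq pos2).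
have [c1 c1P] := op_eigenvalue_bound pos1; have [c2 c2P] := op_eigenvalue_bound pos2.
exists (Num.max c1 c2) => x z h n h0.
have c1P' m : op_eigenvalue A1 m <= expR (Num.max c1 c2).
  by apply: le_trans (c1P m) _; rewrite ler_expR le_max lexx.
have c2P' m : op_eigenvalue A2 m <= expR (Num.max c1 c2).
  by apply: le_trans (c2P m) _; rewrite ler_expR le_max lexx orbT.
rewrite (counting_function_tensor cA1 saA1 nnA1 cA2 saA2 nnA2 tensA pos1 pos2) ?expR_gt0//.
split; first exact: product_count_le.
exact: (@product_count_ge _ _ _ _ l1 l2 fin1 fin2 c1P' c2P').
Qed.

End CountingFunction.

(** * Primitives *)

Section Primitives.
Context (R : realType).
Notation mu := (@lebesgue_measure R).

(** Integrating from a point [c'] strictly between [c] and [a] makes the derivative two-sided at [a]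
    itself. *)
Lemma primitive_exists (g : R -> R) (c a : R) :
  c < a -> (forall u, c < u -> {for u, continuous g}) ->
  exists P : R -> R, (forall u, a <= u -> is_derive u (1 : R) P (g u)) /\
    (forall u, a <= u -> P u - P a = \int[mu]_(t in `[a, u]) g t).
Proof.
move=> ca cg; pose c' := (c + a) / 2.
have [cc' c'a] : c < c' /\ c' < a by rewrite !midf_lt.
have ig u v : c < u -> mu.-integrable `[u, v] (EFin \o g).
  move=> cu; apply: continuous_compact_integrable; first exact: segment_compact.
  apply: continuous_in_subspaceT => x; rewrite inE/= in_itv/= => /andP[ux _].
  by apply: cg; exact: lt_le_trans ux.
exists (fun u => \int[mu]_(t in `[c', u]) g t); split=> u au.
  have c'u : c' < u by exact: lt_le_trans au.
  have [dP eP] := @continuous_FTC1_closed _ g c' u (u + 1) (ltac:(by rewrite ltrDl)) (ig _ _ cc') c'u (cg _ (lt_trans cc' c'u)).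
  by apply: DeriveDef; [exact: dP|rewrite -derive1E; exact: eP].
rewrite Rintegral_itvB ?bnd_simp//; [|exact: ig|exact: ltW].
rewrite Rintegral_itv_obnd_cbnd//; apply: integrableS (ig c' u cc') => //.
by apply: subset_itv; rewrite bnd_simp// ltW.
Qed.

Lemma derive_le (P Q p q : R -> R) (a b : R) : a <= b ->
  (forall u, a <= u <= b -> is_derive u (1 : R) P (p u)) ->
  (forall u, a <= u <= b -> is_derive u (1 : R) Q (q u)) ->
  (forall u, a <= u <= b -> p u <= q u) -> P b - P a <= Q b - Q a.
Proof.
move=> ab dP dQ pq.
have dPQ u : a <= u <= b -> is_derive u (1 : R) (Q - P) (q u - p u).
  by move=> uab; apply: is_deriveB; [exact: dQ|exact: dP].
have [| |x + e] := @MVT_segment R (Q - P) (fun u => q u - p u) a b ab.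
- by move=> x; rewrite in_itv/= => /andP[ax xb]; apply: dPQ; rewrite !ltW.
- apply: continuous_in_subspaceT => x; rewrite inE/= in_itv/= => xab.
  apply: differentiable_continuous; apply/derivable1_diffP.
  exact: (@ex_derive _ _ _ _ _ _ _ (dPQ x xab)).
rewrite in_itv/= => xab.
have {}e : (Q b - P b) - (Q a - P a) = (q x - p x) * (b - a) := e.
have : 0 <= (q x - p x) * (b - a) by rewrite mulr_ge0// subr_ge0 ?pq.
by rewrite -e; lra.
Qed.

Lemma derive_le_cst (P p : R -> R) (a b m : R) : a <= b ->
  (forall u, a <= u <= b -> is_derive u (1 : R) P (p u)) ->
  (forall u, a <= u <= b -> p u <= m) -> P b - P a <= m * (b - a).
Proof.
move=> ab dP pm; rewrite mulrBr.
apply: (@derive_le P (fun u => m * u) p (fun=> m)) => // u _.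
by apply: is_derive_eq; rewrite scaler1.
Qed.

Lemma derive_ge_cst (P p : R -> R) (a b m : R) : a <= b ->
  (forall u, a <= u <= b -> is_derive u (1 : R) P (p u)) ->
  (forall u, a <= u <= b -> m <= p u) -> m * (b - a) <= P b - P a.
Proof.
move=> ab dP pm; rewrite mulrBr.
apply: (@derive_le (fun u => m * u) P (fun=> m) p) => // u _.
by apply: is_derive_eq; rewrite scaler1.
Qed.

End Primitives.

(** * Periodic functions and equidistribution *)

Section ExponentiallyMonotone.
Context (R : realType).

(* [rho] must be increasing, because [s] is periodic and bounded away from 0. *)
Lemma admissible_growth (p T : R) (s : R -> R) : 0 < p -> admissible_periodic p T s ->
  forall u v, u <= v -> s u <= expR (1 / p * (v - u)) * s v.
Proof.
move=> p0 [T0 per _ [m [B [m0 sB]]] [rho [mono sE]]].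
have spos x : 0 < s x by have /andP[h _] := sB x; exact: lt_le_trans h.
have rhoE x : rho x = expR (x / p) * s x.
  by rewrite sE mulNr mulrA -expRD addrN expR0 mul1r.
have incr : {homo rho : x y / x <= y}.
  case: mono => // decr; exfalso; have := decr T 0 (ltW T0).
  have sT : s T = s 0 by rewrite -[T]add0r per.
  rewrite !rhoE mul0r expR0 mul1r sT leNgt => /negP; apply.
  by rewrite ltr_pMl// expR_gt1 divr_gt0.
move=> u v uv; have := incr _ _ uv; rewrite !rhoE => h.
rewrite -(ler_pM2l (expR_gt0 (u / p))); apply: le_trans h _.
by rewrite mulrA -expRD mul1r mulrBr (mulrC _ v) (mulrC _ u) subrKC.
Qed.

Variables (a T B M : R) (s S : R -> R).
Hypotheses (a0 : 0 < a) (T0 : 0 < T).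
Hypothesis per : forall x, s (x + T) = s x.
Hypothesis s_gt0 : forall x, 0 < s x.
Hypothesis s_le : forall x, s x <= B.
Hypothesis growth : forall u v, u <= v -> s u <= expR (a * (v - u)) * s v.
Hypothesis dS : forall u : R, 0 <= u -> is_derive u (1 : R) S (s u).
Hypothesis S_M : S T - S 0 = T * M.

Lemma periodicMn n x : s (x + n%:R * T) = s x.
Proof.
elim: n => [|n IH]; first by rewrite mul0r addr0.
by rewrite -natr1 mulrDl mul1r addrA per.
Qed.

Lemma periodicMz (n : int) x : s (x + n%:~R * T) = s x.
Proof.
case: n => n; first exact: periodicMn.
by rewrite NegzE mulrNz mulNr -[in RHS](subrK (n.+1%:R * T) x) periodicMn.
Qed.

Lemma primitive_period x : 0 <= x -> S (x + T) - S x = T * M.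
Proof.
move=> x0; rewrite -S_M.
have dST (u : R) : 0 <= u <= x -> is_derive u (1 : R) (fun y => S (y + T)) (s u).
  move=> /andP[u0 _]; rewrite -[s u]per -[s (u + T)]mulr1.
  have dSu : is_derive (u + T) (1 : R) S (s (u + T)) by apply: dS; rewrite addr_ge0// ltW.
  have := @is_derive1_comp R S (fun y => y + T) u (s (u + T)) 1 dSu.
  apply.
  by apply: is_derive_eq; rewrite addr0.
have dS' (u : R) : 0 <= u <= x -> is_derive u (1 : R) S (s u) by move=> /andP[/dS].
have := derive_le x0 dST dS' (fun u _ => lexx (s u)).
have := derive_le x0 dS' dST (fun u _ => lexx (s u)).
by rewrite add0r; lra.
Qed.

Lemma primitive_mono x y : 0 <= x -> x <= y -> 0 <= S y - S x <= B * (y - x).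
Proof.
move=> x0 xy; have dS' (u : R) : x <= u <= y -> is_derive u (1 : R) S (s u).
  by move=> /andP[xu _]; apply: dS; exact: le_trans xu.
apply/andP; split; last by apply: (derive_le_cst xy dS') => u _; exact: s_le.
by rewrite -[leLHS](mul0r (y - x)); apply: (derive_ge_cst xy dS') => u _; exact: ltW.
Qed.

(** By [growth], [s] stays above [s 0 * expR (- (a * T))] on the period [[0, T]]. *)
Lemma mean_gt0 : 0 < M.
Proof.
suff : 0 < T * M by rewrite pmulr_rgt0.
rewrite -S_M.
have h : s 0 * expR (- (a * T)) * (T - 0) <= S T - S 0.
  apply: (@derive_ge_cst _ S s) => [|u /andP[/dS//]|u /andP[u0 uT]]; first exact: ltW.
  have := growth u0; rewrite subr0 => h.
  rewrite -(ler_pM2l (expR_gt0 (a * u))); apply: le_trans h.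
  rewrite mulrC -mulrA -expRD -[leRHS]mulr1 ler_pM2l// -expR0 ler_expR addrC subr_le0.
  by rewrite ler_pM2l.
by apply: lt_le_trans h; rewrite subr0 !mulr_gt0// expR_gt0.
Qed.

(** For [u] between [x] and [x + d], [growth] gives [s x <= expR (a * d) * s u] and
    [s u <= expR (a * d) * s (x + d)]. This one-sided control takes the place of a modulus of
    continuity and makes the Riemann sums explicit. *)
Lemma riemann_step x d : 0 <= x -> 0 < d ->
  expR (- (a * d)) * (d * s x) <= S (x + d) - S x /\
  expR (- (a * d)) * (S (x + d) - S x) <= d * s (x + d).
Proof.
move=> x0 d0; have xd : x <= x + d by rewrite lerDl ltW.
have dS' (u : R) : x <= u <= x + d -> is_derive u (1 : R) S (s u).
  by move=> /andP[xu _]; apply: dS; exact: le_trans xu.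
have xdx : x + d - x = d by ring.
split.
  have -> : expR (- (a * d)) * (d * s x) = expR (- (a * d)) * s x * (x + d - x) by rewrite xdx; ring.
  apply: (derive_ge_cst xd dS') => u /andP[xu ud].
  rewrite mulrC expRN ler_pdivrMr ?expR_gt0// mulrC; apply: le_trans (growth xu) _.
  by rewrite ler_pM2r// ler_expR ler_pM2l// lerBlDl.
rewrite mulrC expRN ler_pdivrMr ?expR_gt0//.
have -> : d * s (x + d) * expR (a * d) = expR (a * d) * s (x + d) * (x + d - x) by rewrite xdx; ring.
apply: (derive_le_cst xd dS') => u /andP[xu ud].
apply: le_trans (growth ud) _; rewrite ler_pM2r// ler_expR ler_pM2l//; lra.
Qed.

(** The sum over right endpoints differs from the one over left endpoints by its two extreme terms,
    which cost at most [B]. *)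
Lemma riemann_sum_bounds x d J : 0 <= x -> 0 < d ->
  expR (- (a * d)) * (d * \sum_(j < J) s (x + j%:R * d)) <= S (x + J%:R * d) - S x /\
  expR (- (a * d)) * (S (x + J%:R * d) - S x) <= d * (\sum_(j < J) s (x + j%:R * d) + B).
Proof.
move=> x0 d0; have [h1 h2] : expR (- (a * d)) * (d * \sum_(j < J) s (x + j%:R * d)) <= S (x + J%:R * d) - S x /\
  expR (- (a * d)) * (S (x + J%:R * d) - S x) <= d * (\sum_(j < J) s (x + j%:R * d) + s (x + J%:R * d) - s x).
  elim: J => [|J [IH1 IH2]].
    by rewrite !big_ord0 !mul0r !addr0 add0r !subrr !mulr0.
  have xJ : 0 <= x + J%:R * d by rewrite addr_ge0// mulr_ge0// ltW.
  have [h1 h2] := riemann_step xJ d0.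
  have e : x + J%:R * d + d = x + J.+1%:R * d by rewrite -addrA -{2}[d]mul1r -mulrDl natr1.
  rewrite e in h1 h2; rewrite !big_ord_recr /=.
  by split; [lra|lra].
split=> //; apply: le_trans h2 _; rewrite ler_pM2l//.
by have := s_le (x + J%:R * d); have := s_gt0 x; lra.
Qed.

Lemma riemann_sum_approx eps : 0 < eps -> exists2 d0, 0 < d0 &
  forall d J, 0 < d <= d0 -> T - d <= J%:R * d <= T ->
  forall x, `|\sum_(j < J) s (x + j%:R * d) - J%:R * M| <= eps * J%:R.
Proof.
move=> e0; have M0 := mean_gt0.
have B0 : 0 < B by exact: lt_le_trans (s_gt0 0) (s_le 0).
(* [d1] yields [T * M <= (1 - a * d) * (T - d) * (M + eps)] for the upper bound, [d2] yields [T * (M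
   - eps) <= (1 - a * d) * (T * M - B * d) - d * B] for the lower one; [(2 * a)^-1] keeps
   [1 - a * d] positive. *)
pose d1 := T * eps / ((1 + a * T) * (M + eps)).
pose d2 := T * eps / (a * T * M + 2 * B).
have den1 : 0 < (1 + a * T) * (M + eps) by rewrite mulr_gt0 ?addr_gt0 ?mulr_gt0.
have den2 : 0 < a * T * M + 2 * B by rewrite addr_gt0 ?mulr_gt0.
exists (Num.min (2 * a)^-1 (Num.min d1 d2)).
  by rewrite !lt_min invr_gt0 mulr_gt0//= !divr_gt0// mulr_gt0.
move=> d J /andP[d0]; rewrite !le_min => /and3P[da dd1 dd2] /andP[Jd JT] x.
(* [S] is a primitive only on the half-line from 0, so [x] is first moved there by whole periods. *)
wlog x0 : x / 0 <= x.
  move=> h; have [n xn] : exists n : nat, 0 <= x + n%:R * T.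
    exists (Num.bound (`|x| / T)); rewrite -lerBlDl sub0r -ler_pdivrMr//.
    apply: (@le_trans _ _ (`|x| / T)); first by rewrite ler_pM2r ?invr_gt0// -normrN ler_norm.
    by apply: ltW; apply: archi_boundP; rewrite divr_ge0// ltW.
  have := h _ xn; congr (`|_ - _| <= _); apply: eq_bigr => j _.
  by rewrite addrAC periodicMn.
have [h1 h2] := riemann_sum_bounds J x0 d0.
set Sg := \sum_(j < J) _ in h1 h2 *; set I := S (x + _) - _ in h1 h2.
have Sg0 : 0 <= Sg by apply: sumr_ge0 => j _; exact: ltW.
have xJ : 0 <= x + J%:R * d by rewrite addr_ge0// mulr_ge0// ltW.
have xJT : x + J%:R * d <= x + T by rewrite lerD2l.
have /andP[i1 i2] := primitive_mono xJ xJT.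
have iT := primitive_period x0.
have q1 : 1 - a * d <= expR (- (a * d)) by exact: expR_ge1Dx.
set q := expR _ in h1 h2 q1.
have ad : a * d <= 1 / 2.
  by rewrite mulrC -ler_pdivlMr// (le_trans da)// invfM div1r.
rewrite ler_pdivlMr// in dd1; rewrite ler_pdivlMr// in dd2.
have I1 : I <= T * M by rewrite /I; lra.
have I2 : T * M - B * d <= I by rewrite /I; nra.
set K := J%:R * d in Jd JT xJ i1 i2.
have up : d * Sg <= K * (M + eps).
  have u1 : (1 - a * d) * (d * Sg) <= T * M.
    by apply: le_trans I1; apply: le_trans h1; rewrite ler_wpM2r// mulr_ge0// ltW.
  have u2 : T * M <= (1 - a * d) * (K * (M + eps)).
    have : (1 - a * d) * ((T - d) * (M + eps)) <= (1 - a * d) * (K * (M + eps)).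
      by rewrite ler_wpM2l ?ler_wpM2r//; [|rewrite addr_ge0// ltW]; lra.
    apply: le_trans.
    have -> : (1 - a * d) * ((T - d) * (M + eps)) =
      T * M + (T * eps - d * ((1 + a * T) * (M + eps))) + a * d * d * (M + eps) by ring.
    have : 0 <= a * d * d * (M + eps) by rewrite !mulr_ge0 ?addr_ge0// ltW.
    lra.
  have ad1 : 0 < 1 - a * d by lra.
  by rewrite -(ler_pM2l ad1); exact: le_trans u2.
have lo : K * (M - eps) <= d * Sg.
  have [Me|eM] := leP M eps.
    apply: (@le_trans _ _ 0); last by rewrite mulr_ge0// ltW.
    by rewrite mulr_ge0_le0 ?subr_le0// mulr_ge0// ltW.
  have l1 : (1 - a * d) * (T * M - B * d) <= d * (Sg + B).
    have I0 : 0 <= I.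
      have xK : x <= x + K by rewrite lerDl mulr_ge0// ltW.
      by have /andP[] := primitive_mono x0 xK.
    apply: le_trans h2; apply: le_trans (_ : (1 - a * d) * I <= _); last by rewrite ler_wpM2r.
    by rewrite ler_wpM2l//; lra.
  have l2 : K * (M - eps) <= T * (M - eps) by rewrite ler_wpM2r// subr_ge0 ltW.
  have l3 : 0 <= a * d * (B * d) by rewrite !mulr_ge0// ltW.
  have e1 : (1 - a * d) * (T * M - B * d) = T * M - d * (a * T * M + B) + a * d * (B * d) by ring.
  rewrite e1 in l1.
  have e2 : d * (a * T * M + 2 * B) = d * (a * T * M + B) + d * B by ring.
  rewrite e2 in dd2; lra.
rewrite ler_distl; apply/andP; split; rewrite -(ler_pM2l d0).
  by have -> : d * (J%:R * M - eps * J%:R) = K * (M - eps) by rewrite /K; ring.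
by have -> : d * (J%:R * M + eps * J%:R) = K * (M + eps) by rewrite /K; ring.
Qed.

(** Pigeonhole: among [n + 2] fractional parts two fall in the same of [n + 1] boxes. Irrationality
    keeps their difference nonzero. *)
Lemma dirichlet_irrational (th : R) n : irrational th -> exists q (p : int),
  [/\ (0 < q)%N, 0 < `|q%:R * th - p%:~R| & `|q%:R * th - p%:~R| <= n.+1%:R^-1].
Proof.
move=> irr; pose fr (q : nat) : R := q%:R * th - (Num.floor (q%:R * th))%:~R.
have fr01 q : 0 <= fr q < 1.
  have /andP[h1 h2] := floor_itv (q%:R * th : R).
  by rewrite intrD in h2; apply/andP; split; rewrite /fr; lra.
have n0 : 0 < n.+1%:R :> R by [].
pose f (q : 'I_n.+2) : 'I_n.+1 := inord (Num.truncn (n.+1%:R * fr q)).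
have [q [q' [qq' fq]]] : exists q q' : 'I_n.+2, (q < q')%N /\ f q = f q'.
  apply: contrapT => nex; have : injective f.
    move=> q q' fq; apply/val_inj/eqP; rewrite -[_ == _]negbK neq_ltn; apply/negP.
    by case/orP => lt; apply: nex; [exists q, q'|exists q', q].
  by move=> /leq_card; rewrite !card_ord ltnn.
have tr (r : 'I_n.+2) : (f r)%:R <= n.+1%:R * fr r < (f r)%:R + 1.
  have /andP[f0 f1] := fr01 r.
  have nf0 : 0 <= n.+1%:R * fr r by rewrite mulr_ge0.
  have /andP[t1 t2] := truncn_itv nf0; rewrite /f inordK ?t1 ?natr1//.
  by rewrite -(ltr_nat R); apply: le_lt_trans t1 _; rewrite gtr_pMr.
exists (q' - q)%N, (Num.floor (q'%:R * th) - Num.floor (q%:R * th)).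
have e : (q' - q)%:R * th - (Num.floor (q'%:R * th) - Num.floor (q%:R * th))%:~R = fr q' - fr q.
  by rewrite natrB 1?ltnW// intrB /fr; ring.
split; first by rewrite subn_gt0.
  rewrite normr_gt0; apply/eqP => e0; apply: irr; apply/rationalP.
  exists (Num.floor (q'%:R * th) - Num.floor (q%:R * th)), (q' - q)%N.
  move/eqP: e0; rewrite subr_eq0 => /eqP <-.
  by rewrite mulrAC divff ?mul1r// pnatr_eq0 -lt0n subn_gt0.
rewrite e -(ler_pM2l n0) mulfV ?gt_eqF// -{1}(gtr0_norm n0) -normrM mulrBr ler_norml.
by have := tr q; have := tr q'; rewrite fq => /andP[? ?] /andP[? ?]; apply/andP; split; lra.
Qed.

Lemma sum_blocks (F : nat -> R) (J q : nat) :
  \sum_(i < J * q) F i = \sum_(j < J) \sum_(i < q) F (j * q + i)%N.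
Proof.
elim: J => [|J IH]; first by rewrite mul0n !big_ord0.
rewrite big_ord_recr /= -IH mulSn addnC big_split_ord /=.
by congr (_ + _); apply: eq_bigr.
Qed.

(* If [dd = q T1 - p T] is small and nonzero, sampling [s] with step [q T1]
   amounts to sampling it with step [dd], which gives Riemann sums of [s]. *)
Lemma weyl_equidistribution (T1 eps : R) : irrational (T1 / T) -> 0 < eps ->
  exists2 Q, (0 < Q)%N & forall y,
    `|\sum_(q < Q) s (y - q%:R * T1) - Q%:R * M| <= eps * Q%:R.
Proof.
move=> irr e0; have [d0 d00 hd] := riemann_sum_approx e0.
(* The bound [T] ensures that at least one step of length [d] fits in a period, hence [0 < J]. *)
pose d1 := Num.min d0 T; have d10 : 0 < d1 by rewrite lt_min d00.
have [q [p [q0 qp0 qp]]] := dirichlet_irrational (Num.bound (T / d1)) irr.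
pose dd := q%:R * T1 - p%:~R * T.
have ddE : dd = T * (q%:R * (T1 / T) - p%:~R).
  by rewrite /dd mulrBr (mulrC T p%:~R) mulrCA [T * _]mulrC divfK ?gt_eqF.
pose d := `|dd|.
have d_gt0 : 0 < d by rewrite /d ddE normrM mulr_gt0// normr_gt0 gt_eqF.
have dd1 : d <= d1.
  rewrite /d ddE normrM gtr0_norm//; apply: le_trans (ler_wpM2l (ltW T0) qp) _.
  rewrite ler_pdivrMr// mulrC -ler_pdivrMr//; apply: ltW.
  apply: lt_trans (archi_boundP _) _; first by rewrite divr_ge0 ?ltW.
  by rewrite ltr_nat.
have /andP[dd0 ddT] : (d <= d0) && (d <= T) by move: dd1; rewrite /d1 le_min.
pose J := Num.truncn (T / d).
have /andP[J1 J2] : J%:R <= T / d < J.+1%:R by apply: truncn_itv; rewrite divr_ge0 ?ltW.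
rewrite ler_pdivlMr// in J1; rewrite ltr_pdivrMr// -natr1 mulrDl mul1r in J2.
have J0 : (0 < J)%N by rewrite lt0n; apply: contraTneq J2 => ->; rewrite mul0r add0r ltNge ddT.
exists (J * q)%N; first by rewrite muln_gt0 J0.
(* With [r = j q + i] and [i] fixed, the points move by [q T1], that is by [dd] modulo [T], and [j]
   runs through one Riemann sum over nearly a period. *)
move=> y; rewrite (sum_blocks (fun r => s (y - r%:R * T1))) exchange_big /=.
have step (i : 'I_q) : `|\sum_(j < J) s (y - (j * q + i)%:R * T1) - J%:R * M| <= eps * J%:R.
  have e (j : nat) : s (y - (j * q + i)%:R * T1) = s (y - i%:R * T1 - j%:R * dd).
    rewrite -(periodicMz (- (j%:Z * p)) (y - i%:R * T1 - j%:R * dd)); congr s.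
    by rewrite /dd natrD natrM mulrNz intrM /=; ring.
  under eq_bigr do rewrite e.
  have hJ : T - d <= J%:R * d <= T by rewrite J1 andbT; lra.
  have hd' : 0 < d <= d0 by rewrite d_gt0.
  (* The sampling points descend by [dd]. For [dd < 0] this is a forward sum with step [d];
     otherwise the sum is read backwards from its lowest point. *)
  have [dpos|dneg] := leP 0 dd; last first.
    have -> : dd = - d by rewrite /d ltr0_norm// opprK.
    have := hd d J hd' hJ (y - i%:R * T1).
    by congr (`|_ - _| <= _); apply: eq_bigr => j _; rewrite mulrN opprK.
  have -> : dd = d by rewrite /d ger0_norm.
  have := hd d J hd' hJ (y - i%:R * T1 - J.-1%:R * d).
  rewrite (reindex_inj rev_ord_inj) /=.
  congr (`|_ - _| <= _); apply: eq_bigr => j _; congr s.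
  by rewrite natrB ?ltn_ord// -subn1 natrB// -natr1; ring.
have -> : \sum_(i < q) \sum_(j < J) s (y - (j * q + i)%:R * T1) - (J * q)%:R * M =
   \sum_(i < q) (\sum_(j < J) s (y - (j * q + i)%:R * T1) - J%:R * M).
  by rewrite sumrB sumr_const card_ord -mulr_natr natrM; ring.
apply: le_trans (ler_norm_sum _ _ _) _; apply: le_trans (ler_sum _ (fun i _ => step i)) _.
by rewrite sumr_const card_ord -[leLHS]mulr_natr natrM mulrA.
Qed.

End ExponentiallyMonotone.

(** * Slowly varying functions *)

Section SlowlyVaryingLog.
Context (R : realType).
Notation mu := (@lebesgue_measure R).

(** Slow variation in the logarithmic variable, uniform over shifts of length at most [W];
    exchanging [u] and [v] gives the reverse estimate. *)
Definition slow (f : R -> R) := forall eta W : R, 0 < eta ->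
  exists K, forall u v, K <= u -> K <= v -> `|u - v| <= W -> f u <= (1 + eta) * f v.

Variable phi : R -> R.
Hypothesis phi_sv : smooth_slowly_varying phi.
Let f u := phi (expR u).

Let phi_gt0 t : 0 < t -> 0 < phi t.
Proof. by have [[h _ _] _ _ _] := phi_sv; exact: h. Qed.

Lemma smooth_sv_continuous t : 0 < t -> {for t, continuous phi}.
Proof.
move=> t0; have [_ C2 _ _] := phi_sv; have [d _ _] := C2 t t0.
by apply: differentiable_continuous; apply/derivable1_diffP.
Qed.

(** The derivative of [ln (f u)] is [t (ln phi)'(t)] at [t = expR u], which tends to 0, so the mean
    value theorem applies. The constant [e] gives [e * W <= eta / (1 + eta)], and
    [expR (- y) >= 1 - y] turns this into the factor [1 + eta]. *)
Lemma smooth_sv_slow : slow f.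
Proof.
move=> eta W eta0; have [_ C2 lim1 _] := phi_sv.
have e10 : 0 < eta / (2 * (`|W| + 1) * (1 + eta)).
  have nW := normr_ge0 W; rewrite divr_gt0// !mulr_gt0//; lra.
set e := _ / _ in e10.
have [M [Mreal MP]] : \forall t \near +oo, `|t * derive1 (@ln R \o phi) t| < e.
  by move/cvgr0_norm_lt : lim1; apply.
have M0 : 0 < `|M| + 1 by rewrite ltr_wpDl.
exists (ln (`|M| + 1)) => u v.
set K := ln _ => Ku Kv uvW.
pose g (y : R) := ln (phi (expR y)).
have dg (y : R) : K <= y -> is_derive y (1 : R) g (derive1 (@ln R \o phi) (expR y) * expR y).
  move=> Ky; have ey := expR_gt0 y; have [dphi _ _] := C2 _ ey.
  apply: (@is_derive1_comp R (@ln R \o phi) expR).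
  rewrite derive1E; apply: DeriveDef => //.
  have h1 := is_derive1_ln (phi_gt0 ey).
  have h2 : is_derive (expR y) (1 : R) phi ('D_1 phi (expR y)) by apply: DeriveDef.
  exact: (@ex_derive _ _ _ _ _ _ _ (is_derive1_comp h1 h2)).
have dgb (y : R) : K <= y -> `|derive1 (@ln R \o phi) (expR y) * expR y| <= e.
  move=> Ky; rewrite mulrC; apply: ltW; apply: MP.
  apply: lt_le_trans (_ : `|M| + 1 <= _); first by apply: le_lt_trans (ler_norm _) _; rewrite ltrDl.
  by rewrite -[leLHS]lnK// ler_expR.
have gl (x y : R) : K <= x -> x <= y -> `|g y - g x| <= e * (y - x).
  move=> Kx xy.
  have dg' (z : R) : x <= z <= y -> is_derive z (1 : R) g (derive1 (@ln R \o phi) (expR z) * expR z).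
    by move=> /andP[xz _]; apply: dg; exact: le_trans xz.
  rewrite ler_norml -mulNr (derive_le_cst xy dg') ?(derive_ge_cst xy dg')// => z /andP[xz _];
    by have := dgb z (le_trans Kx xz); rewrite ler_norml => /andP[].
have guv : g u - g v <= e * W.
  apply: le_trans (ler_norm _) _; apply: le_trans (_ : e * `|u - v| <= _); last by rewrite ler_pM2l.
  have [uv|vu] := leP u v.
    have -> : `|u - v| = v - u by rewrite distrC ger0_norm// subr_ge0.
    by rewrite distrC gl.
  have -> : `|u - v| = u - v by rewrite ger0_norm// subr_ge0 ltW.
  by rewrite gl// ltW.
have fE y : f y = expR (g y) by rewrite /g lnK// posrE phi_gt0// expR_gt0.
rewrite !fE -ler_pdivrMr ?expR_gt0// -expRN -expRD.
have eW : e * W <= eta / (1 + eta).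
  have W0 : 0 < `|W| + 1 by rewrite ltr_wpDl.
  have E1 : e * (2 * (`|W| + 1)) = eta / (1 + eta).
    by rewrite /e; field; rewrite !gt_eqF//; lra.
  rewrite -E1 ler_pM2l//; have := ler_norm W; have := normr_ge0 W; lra.
have : (1 + eta)^-1 <= expR (- (g u - g v)).
  apply: le_trans (expR_ge1Dx _).
  have -> : (1 + eta)^-1 = 1 - eta / (1 + eta) by field; rewrite gt_eqF//; lra.
  lra.
rewrite expRN lef_pV2 ?posrE ?expR_gt0//; lra.
Qed.

(** The substitution [expR] turns integration against [1 / t] into plain integration. If the
    primitive were bounded, exhausting the half-line by [[1, 1 + n]] would bound the logarithmic
    integral. *)
Lemma smooth_sv_primitive : log_integral phi = +oo%E ->
  exists P : R -> R, (forall u : R, 0 <= u -> is_derive u (1 : R) P (f u)) /\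
    (forall L, exists2 u, 0 <= u & L <= P u - P 0).
Proof.
move=> intoo.
have cg (t : R) : 0 < t -> {for t, continuous (fun t => phi t / t)}.
  move=> t0; apply: continuousM; first exact: smooth_sv_continuous.
  by apply: cvgV; [rewrite gt_eqF|exact: cvg_id].
have [Q [dQ iQ]] := @primitive_exists R (fun t => phi t / t) 0 1 ltr01 cg.
exists (Q \o expR); split.
  move=> u u0; have e0 := expR_gt0 u.
  have -> : f u = (phi (expR u) / expR u) * expR u by rewrite divfK// gt_eqF.
  apply: is_derive1_comp; apply: dQ.
  by rewrite -[leLHS]expR0 ler_expR.
move=> L; apply: contrapT => nL.
have QL (t : R) : 1 <= t -> Q t - Q 1 <= L.
  move=> t1; rewrite leNgt; apply/negP => h; apply: nL; exists (ln t); first exact: ln_ge0.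
  by rewrite /= lnK ?posrE ?(lt_le_trans ltr01)// expR0 ltW.
have : (log_integral phi <= L%:E)%E; last by rewrite intoo leye_eq.
have g0 (x : R) : 1 <= x -> 0 <= phi x / x.
  by move=> x1; have x0 := lt_le_trans ltr01 x1; rewrite divr_ge0 ?ltW ?phi_gt0.
have igt (b : R) : mu.-integrable `[1, b] (EFin \o (fun t => phi t / t)).
  apply: continuous_compact_integrable; first exact: segment_compact.
  apply: continuous_in_subspaceT => x; rewrite inE/= in_itv/= => /andP[x1 _].
  by apply: cg; exact: lt_le_trans x1.
rewrite /log_integral itv_bndy_bigcup_BRight.
apply: cvge_le (@ge0_nondecreasing_set_cvg_integral _ _ R _ _ _ _ _ _ _).
- apply: nearW => n.
  have n1 : 1 <= 1 + n%:R :> R by rewrite lerDl.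
  have := QL _ n1; rewrite iQ// /Rintegral -lee_fin fineK//.
  exact: integrable_fin_num (igt _).
- move=> m n mn; rewrite subsetEset; apply: subset_itvl.
  by rewrite bnd_simp lerD2l ler_nat.
- by move=> n; exact: measurable_itv.
- by move=> n; exact: (measurable_int mu (igt _)).
- by move=> n x /=; rewrite in_itv/= => /andP[x1 _]; rewrite lee_fin g0.
Qed.

(** The same substitution turns the Mellin convolution into an additive convolution over
    [[0, x]]. *)
Lemma mellin_primitive (psi : R -> R) : smooth_slowly_varying psi -> forall x, 0 <= x ->
  exists P : R -> R, (forall u : R, 0 <= u -> is_derive u (1 : R) P (f u * psi (expR (x - u)))) /\
    mellin_convolution phi psi (expR x) = P x - P 0.
Proof.
move=> psi_sv x x0; have psi_cont (t : R) : 0 < t -> {for t, continuous psi}.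
  by move=> t0; have [_ C2 _ _] := psi_sv; have [d _ _] := C2 t t0;
    apply: differentiable_continuous; apply/derivable1_diffP.
have ex := expR_gt0 x.
have cg (t : R) : 0 < t -> {for t, continuous (fun t => phi t * psi (expR x / t) / t)}.
  move=> t0; have ct : {for t, continuous (fun t : R => t^-1)} by apply: cvgV; [rewrite gt_eqF|exact: cvg_id].
  apply: continuousM; last exact: ct.
  apply: continuousM; first exact: smooth_sv_continuous.
  have c1 : {for t, continuous (fun t : R => expR x / t)}.
    by apply: continuousM => //; exact: cvg_cst.
  have c2 : {for (expR x / t), continuous psi} by apply: psi_cont; rewrite divr_gt0.
  exact: (@continuous_comp _ _ _ (fun t : R => expR x / t) psi t c1 c2).
have [Q [dQ iQ]] := @primitive_exists R (fun t => phi t * psi (expR x / t) / t) 0 1 ltr01 cg.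
exists (Q \o expR); split; last first.
  rewrite /mellin_convolution -iQ; first by rewrite -expR0.
  by rewrite -[leLHS]expR0 ler_expR.
move=> u u0; have e0 := expR_gt0 u.
have -> : f u * psi (expR (x - u)) = (phi (expR u) * psi (expR x / expR u) / expR u) * expR u.
  by rewrite divfK ?gt_eqF// expRD expRN.
apply: is_derive1_comp; apply: dQ.
by rewrite -[leLHS]expR0 ler_expR.
Qed.

End SlowlyVaryingLog.

(** * Asymptotics of the pair count *)

Section Cells.
Context (R : realType).
Variables (a T B M : R) (s S : R -> R).
Hypotheses (a0 : 0 < a) (T0 : 0 < T).
Hypothesis per : forall x, s (x + T) = s x.
Hypothesis s_gt0 : forall x, 0 < s x.
Hypothesis s_le : forall x, s x <= B.
Hypothesis growth : forall u v, u <= v -> s u <= expR (a * (v - u)) * s v.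
Hypothesis dS : forall u : R, 0 <= u -> is_derive u (1 : R) S (s u).
Hypothesis S_M : S T - S 0 = T * M.

(** By periodicity the shifted and unshifted sums over a period agree, so the total weight is
    [expR (a * h) - 1], about [a * h], times a Riemann sum of about [m * M]. *)
Lemma cell_bounds eps : 0 < eps -> eps <= 1 -> exists m, let h := T / m%:R in
  [/\ (0 < m)%N, expR (a * h) <= 1 + eps &
  (1 - eps) * (a * T * M) <= \sum_(r < m) (expR (a * h) * s (r%:R * h + h) - s (r%:R * h))
    <= (1 + eps) * (a * T * M)].
Proof.
move=> e0 e1; have M0 := mean_gt0 a0 T0 s_gt0 growth dS S_M.
have e3 : 0 < eps / 3 * M by rewrite mulr_gt0// divr_gt0.
have [d0 d00 hd] := riemann_sum_approx a0 T0 per s_gt0 s_le growth dS S_M e3.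
(* The second bound gives [a * h <= eps / 6], hence [E <= 1 + eps / 3]; together with the tolerance
   [eps / 3] of the Riemann sum it leaves [(1 + eps / 3) ^+ 2 <= 1 + eps]. *)
pose d1 := Num.min d0 (eps / (6 * a)).
have d10 : 0 < d1 by rewrite lt_min d00 divr_gt0// mulr_gt0.
pose m := (Num.bound (T / d1)).+1; exists m => h.
have m0 : 0 < m%:R :> R by [].
have h0 : 0 < h by rewrite divr_gt0.
have mh : m%:R * h = T by rewrite mulrC divfK// gt_eqF.
have hd1 : h <= d1.
  rewrite ler_pdivrMr// mulrC -ler_pdivrMr//; apply: ltW.
  apply: lt_trans (archi_boundP _) _; first by rewrite divr_ge0 ?ltW.
  by rewrite ltr_nat.
have /andP[hd0 hd2] : (h <= d0) && (h <= eps / (6 * a)) by move: hd1; rewrite le_min.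
have ah : a * h <= eps / 6.
  by move: hd2; rewrite invfM mulrA ler_pdivlMr// mulrC.
have ah0 : 0 < a * h by rewrite mulr_gt0.
set E := expR (a * h).
have E1 : a * h <= E - 1 by have := expR_ge1Dx (a * h); rewrite /E; lra.
have E2 : E - 1 <= a * h * E.
  have := expR_ge1Dx (- (a * h)); rewrite expRN -/E => hh.
  have E0 : 0 < E by exact: expR_gt0.
  have := ler_wpM2r (ltW E0) hh; rewrite mulVf ?gt_eqF// mulrDl mul1r mulNr; lra.
have E3 : E <= 1 + eps / 3 by nra.
split=> //; first by lra.
have hT : T - h <= m%:R * h <= T by rewrite mh lexx andbT; lra.
have hh : 0 < h <= d0 by rewrite h0.
have := hd h m hh hT 0; under eq_bigr do rewrite add0r.
set Sg := \sum_(j < m) s (j%:R * h) => SgE.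
have shift : \sum_(j < m) s (j%:R * h + h) = Sg.
  apply: (@addrI _ (s 0)); transitivity (\sum_(j < m.+1) s (j%:R * h)).
    rewrite [RHS]big_ord_recl /= mul0r; congr (_ + _); apply: eq_bigr => j _.
    by rewrite /bump /= add1n -natr1 mulrDl mul1r.
  by rewrite [LHS]big_ord_recr /= mh -[T]add0r per addrC.
have -> : \sum_(r < m) (E * s (r%:R * h + h) - s (r%:R * h)) = (E - 1) * Sg.
  by rewrite sumrB -mulr_sumr shift mulrBl mul1r.
move: SgE; rewrite ler_distl => /andP[S1 S2].
have Sg1 : m%:R * (1 - eps / 3) * M <= Sg by lra.
have Sg2 : Sg <= m%:R * (1 + eps / 3) * M by lra.
have Sg0 : 0 <= Sg.
  by apply: le_trans Sg1; rewrite !mulr_ge0// ?ltW//; lra.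
have aTM : a * T * M = a * h * (m%:R * M) by rewrite -mh; ring.
have mM : 0 < m%:R * M by rewrite mulr_gt0.
have aTM' c : c * (a * T * M) = a * h * (c * (m%:R * M)) by rewrite aTM; ring.
rewrite !aTM'; apply/andP; split.
  apply: (@le_trans _ _ (a * h * Sg)); last by rewrite ler_wpM2r.
  by rewrite ler_pM2l//; nra.
apply: (@le_trans _ _ (a * h * (E * Sg))); first by rewrite mulrA ler_wpM2r.
rewrite ler_pM2l//.
apply: (@le_trans _ _ ((1 + eps / 3) * Sg)); first by rewrite ler_wpM2r.
apply: (@le_trans _ _ ((1 + eps / 3) * (m%:R * (1 + eps / 3) * M))); first by rewrite ler_wpM2l//; lra.
have -> : (1 + eps / 3) * (m%:R * (1 + eps / 3) * M) = (1 + eps / 3) ^+ 2 * (m%:R * M) by ring.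
rewrite ler_pM2r//; nra.
Qed.

End Cells.

Section Frozen.
Context (R : realType).

Definition asymptotic (a : R) (N f s : R -> R) := forall eta, 0 < eta -> exists K,
  forall x, K <= x -> `|N x - expR (a * x) * f x * s x| <= eta * (expR (a * x) * f x * s x).

Lemma asymptotic_frozen (a : R) (N f s : R -> R) :
  (forall x, 0 < f x) -> (forall x, 0 < s x) -> slow f -> asymptotic a N f s ->
  forall eta W, 0 < eta <= 1 -> exists K, forall u v, K <= u -> K <= v -> `|u - v| <= W ->
    `|N u - expR (a * u) * f v * s u| <= 3 * eta * (expR (a * u) * f v * s u).
Proof.
move=> f0 s0 sl asy eta W /andP[e0 e1].
have [K1 K1P] := sl eta W e0; have [K2 K2P] := asy eta e0.
exists (Num.max K1 K2) => u v; rewrite !ge_max => /andP[u1 u2] /andP[v1 v2] uv.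
have h1 := K1P u v u1 v1 uv; have h2 := K1P v u v1 u1 (ltac:(by rewrite distrC)).
have := K2P u u2; have e : 0 < expR (a * u) * s u by rewrite mulr_gt0 ?expR_gt0.
have -> : expR (a * u) * f u * s u = (expR (a * u) * s u) * f u by ring.
have -> : expR (a * u) * f v * s u = (expR (a * u) * s u) * f v by ring.
set y := expR _ * _ in e *; have fu := f0 u; have fv := f0 v.
rewrite !ler_distl => /andP[n1 n2].
have g1 : f u * (1 + eta) <= f v * (1 + 3 * eta) by nra.
have g2 : f v * (1 - 3 * eta) <= f u * (1 - eta) by nra.
have := ler_wpM2l (ltW e) g1; have := ler_wpM2l (ltW e) g2.
by move=> ? ?; apply/andP; split; lra.
Qed.

End Frozen.

(** * The contribution of one window *)

Section Window.
Context (R : realType).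

(** An increment is a difference of close quantities, so its error is measured against the bound [c]
    of the values and not against the increment; [9] is [2 * 3 + 3]. *)
Lemma cell_error (E t t' y y' c q : R) : 3 * q * t' <= 3 * q * c -> 3 * q * t <= 3 * q * c ->
  1 <= E -> E <= 2 -> `|y - t| <= 3 * q * t -> `|y' - t'| <= 3 * q * t' ->
  `|E * y' - y - (E * t' - t)| <= 9 * q * c.
Proof.
move=> q1 q2 E1 E2 h1 h2.
have -> : E * y' - y - (E * t' - t) = E * (y' - t') - (y - t) by ring.
apply: le_trans (ler_normB _ _) _; rewrite normrM ger0_norm; last by lra.
have h3 : `|y' - t'| <= 3 * q * c by exact: le_trans h2 q1.
have := ler_wpM2r (normr_ge0 (y' - t')) E2; lra.
Qed.

Lemma cell_upper (g d y s q B eps : R) : `|g - d| <= 9 * q * B -> `|y - s| <= 3 * q * s ->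
  0 <= y -> 0 <= d -> 0 < s -> s <= B -> 0 < q -> 3 * q <= eps ->
  g * y <= (1 + eps) * (d * s + 9 * q * B ^+ 2).
Proof.
move=> hg hy y0 d0 s0 sB q0 qe.
have B0 : 0 < B by exact: lt_le_trans sB.
have qB : 0 < 9 * q * B by rewrite !mulr_gt0.
have g1 : g <= d + 9 * q * B by move: hg; rewrite ler_distl => /andP[].
have y1 : y <= (1 + eps) * s.
  move: hy; rewrite ler_distl => /andP[_ yle].
  have qs : 3 * q * s <= eps * s by rewrite ler_pM2r.
  lra.
apply: (@le_trans _ _ ((d + 9 * q * B) * ((1 + eps) * s))).
  by apply: le_trans (ler_wpM2r y0 g1) _; rewrite ler_wpM2l// addr_ge0// ltW.
have -> : (d + 9 * q * B) * ((1 + eps) * s) = (1 + eps) * (d * s + 9 * q * B * s) by ring.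
have e1 : 0 <= 1 + eps by lra.
by rewrite ler_wpM2l// lerD2l expr2 mulrA ler_pM2l.
Qed.

Lemma cell_lower (g d y s q B eps : R) : `|g - d| <= 9 * q * B -> `|y - s| <= 3 * q * s ->
  0 <= y -> 0 <= d -> 0 < s -> s <= B -> 0 < q -> 3 * q <= eps -> eps <= 1 ->
  (1 - eps) * (d * s) - 18 * q * B ^+ 2 <= g * y.
Proof.
move=> hg hy y0 d0 s0 sB q0 qe e1.
have B0 : 0 < B by exact: lt_le_trans sB.
have qB : 0 < 9 * q * B by rewrite !mulr_gt0.
have g1 : d - 9 * q * B <= g by move: hg; rewrite ler_distl => /andP[].
move: hy; rewrite ler_distl => /andP[y1 y2].
have qs : 3 * q * s <= eps * s by rewrite ler_pM2r.
have es : eps * s <= 1 * s by rewrite ler_pM2r.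
have y3 : (1 - eps) * s <= y by lra.
have y4 : y <= 2 * B by lra.
have h1 := ler_wpM2r y0 g1; have h2 := ler_wpM2l d0 y3; have h3 := ler_wpM2l (ltW qB) y4.
have e2 : 9 * q * B * (2 * B) = 18 * q * B ^+ 2 by ring.
have e3 : d * ((1 - eps) * s) = (1 - eps) * (d * s) by ring.
rewrite e2 in h3; rewrite e3 in h2; lra.
Qed.

(** [V] is the ideal value of the window after normalization, and [(1 - eps) * V] the least that its
    share of the convolution can be. The factor [20] absorbs all the accumulated errors when
    [eps <= 1 / 20]. *)
Lemma window_upper_constants (S Sd c D V eps : R) : 0 < eps -> eps <= 1 / 20 -> 0 < V -> 0 < D ->
  S <= (1 + eps) * (Sd + c) -> Sd <= (1 + eps) * D -> 2 * c <= eps * D ->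
  D <= (1 + eps) * V -> S <= (1 + 20 * eps) * ((1 - eps) * V).
Proof.
move=> e0 e1 V0 D0 h1 h2 h3 h4.
have h5 : Sd + c <= (1 + 2 * eps) * D by nra.
have e2 : 0 <= 1 + eps by lra.
have e3 : 0 <= (1 + eps) * (1 + 2 * eps) by rewrite mulr_ge0//; lra.
apply: le_trans h1 _; apply: le_trans (ler_wpM2l e2 h5) _.
rewrite mulrA; apply: le_trans (ler_wpM2l e3 h4) _.
by rewrite !mulrA ler_pM2r//; nra.
Qed.

Lemma window_lower_constants (S Sd c D V E eps : R) : 0 < eps -> eps <= 1 / 20 -> 0 < V -> 0 < D ->
  (1 - eps) * Sd - c <= S -> (1 - eps) * D <= Sd -> c <= eps * D ->
  (1 - eps) * V <= D -> 1 <= E -> E <= 1 + eps ->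
  (1 - 20 * eps) * ((1 + eps) * V) <= E^-1 * S.
Proof.
move=> e0 e1 V0 D0 h1 h2 h3 h4 E1 E2.
have h5 : (1 - 3 * eps) * D <= S by nra.
have e3 : 0 <= 1 - 3 * eps by lra.
have h6 : (1 - 3 * eps) * ((1 - eps) * V) <= S by apply: le_trans h5; rewrite ler_wpM2l.
have E0 : 0 < E by exact: lt_le_trans E1.
rewrite [leRHS]mulrC ler_pdivlMr//; apply: le_trans h6.
apply: (@le_trans _ _ ((1 - 20 * eps) * ((1 + eps) * V) * (1 + eps))).
  rewrite ler_wpM2l// !mulr_ge0//; last exact: ltW; lra.
have -> : (1 - 20 * eps) * ((1 + eps) * V) * (1 + eps) = (1 - 20 * eps) * (1 + eps) ^+ 2 * V by ring.
by rewrite !mulrA ler_pM2r//; nra.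
Qed.

Lemma ratio_bounds (p1 p2 q1 q2 eta eps : R) : 0 < p1 -> 0 < p2 -> 0 < q1 -> 0 < q2 ->
  0 < eta -> 3 * eta <= eps -> eps <= 1 ->
  p1 <= (1 + eta) * q1 -> q1 <= (1 + eta) * p1 -> p2 <= (1 + eta) * q2 -> q2 <= (1 + eta) * p2 ->
  p1 * p2 <= (1 + eps) * (q1 * q2) /\ (1 - eps) * (q1 * q2) <= p1 * p2.
Proof.
move=> p10 p20 q10 q20 eta0 ee e1 h1 h1' h2 h2'.
have sq : (1 + eta) ^+ 2 <= 1 + eps by nra.
have mul_le x1 x2 y1 y2 : 0 < x1 -> 0 < x2 -> 0 < y1 -> 0 < y2 ->
    x1 <= (1 + eta) * y1 -> x2 <= (1 + eta) * y2 -> x1 * x2 <= (1 + eps) * (y1 * y2).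
  move=> x10 x20 y10 y20 l1 l2.
  apply: (@le_trans _ _ (((1 + eta) * y1) * ((1 + eta) * y2))); first by apply: ler_pM => //; exact: ltW.
  have -> : (1 + eta) * y1 * ((1 + eta) * y2) = (1 + eta) ^+ 2 * (y1 * y2) by ring.
  by rewrite ler_pM2r// mulr_gt0.
split; first exact: mul_le.
have := mul_le _ _ _ _ q10 q20 p10 p20 h1' h2'; have p0 : 0 < p1 * p2 by rewrite mulr_gt0.
have e2 : 0 <= 1 - eps by lra.
move=> /(ler_wpM2l e2) /le_trans; apply; rewrite mulrA ger_pMl//; nra.
Qed.

(** The weight depends only on the position [i] within a period. Summing over the periods first
    leaves, for each [i], an unweighted equidistribution sum, and nonnegative weights preserve its
    bounds. *)
Lemma weighted_equidistribution (dd : nat -> R) (s : R -> R) (T h M eps : R) (m Q : nat) :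
  (forall i, 0 <= dd i) -> (forall q i, dd (q * m + i)%N = dd i) -> m%:R * h = T ->
  (forall y, `|\sum_(q < Q) s (y - q%:R * T) - Q%:R * M| <= eps * M * Q%:R) ->
  forall y, (1 - eps) * ((\sum_(i < m) dd i) * Q%:R * M) <=
    \sum_(r < Q * m) dd r * s (y - r%:R * h) <=
    (1 + eps) * ((\sum_(i < m) dd i) * Q%:R * M).
Proof.
move=> dd0 ddp mh weyl y; set D := \sum_(i < m) dd i.
rewrite (sum_blocks (fun r => dd r * s (y - r%:R * h))) exchange_big /=.
have e (i : 'I_m) : \sum_(q < Q) dd (q * m + i)%N * s (y - (q * m + i)%:R * h) =
    dd i * \sum_(q < Q) s (y - i%:R * h - q%:R * T).
  rewrite mulr_sumr; apply: eq_bigr => q _; rewrite ddp; congr (_ * s _).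
  by rewrite -mh natrD natrM; ring.
under eq_bigr do rewrite e.
have e' c : c * (D * Q%:R * M) = \sum_(i < m) dd i * (c * (Q%:R * M)).
  by rewrite -mulr_suml -/D; ring.
rewrite !e'.
have w (i : 'I_m) := weyl (y - i%:R * h).
apply/andP; split; apply: ler_sum => i _; rewrite ler_wpM2l//.
  by have := w i; rewrite ler_distl => /andP[]; lra.
by have := w i; rewrite ler_distl => /andP[]; lra.
Qed.

Variables (a T1 B M1 M2 : R) (f1 f2 s1 s2 N1 N2 : R -> R).
Hypotheses (a0 : 0 < a) (T10 : 0 < T1) (M1_gt0 : 0 < M1) (M2_gt0 : 0 < M2).
Hypothesis (f1_gt0 : forall x, 0 < f1 x) (f2_gt0 : forall x, 0 < f2 x).
Hypothesis (s1_gt0 : forall x, 0 < s1 x) (s2_gt0 : forall x, 0 < s2 x).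
Hypothesis (s1_le : forall x, s1 x <= B) (s2_le : forall x, s2 x <= B).
Hypothesis per1 : forall x, s1 (x + T1) = s1 x.
Hypothesis growth1 : forall u v, u <= v -> s1 u <= expR (a * (v - u)) * s1 v.
Hypothesis (sl1 : slow f1) (sl2 : slow f2).
Hypothesis (as1 : asymptotic a N1 f1 s1) (as2 : asymptotic a N2 f2 s2).
Hypothesis N2_ge0 : forall x, 0 <= N2 x.
Hypothesis cells : forall eps, 0 < eps -> eps <= 1 -> exists m, let h := T1 / m%:R in
  [/\ (0 < m)%N, expR (a * h) <= 1 + eps &
  (1 - eps) * (a * T1 * M1) <= \sum_(r < m) (expR (a * h) * s1 (r%:R * h + h) - s1 (r%:R * h))
    <= (1 + eps) * (a * T1 * M1)].
Hypothesis weyl : forall eps, 0 < eps -> exists2 Q, (0 < Q)%N & forall y,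
    `|\sum_(q < Q) s2 (y - q%:R * T1) - Q%:R * M2| <= eps * Q%:R.

(** Up to the common factor [X = expR (a * x) * f1 z * f2 (x - z)], both cell sums have terms
    [g r * y2], with [g r] close to the weight [dd r] and [y2] close to [s2]. Equidistribution
    evaluates them, and [X * W] is compared with the integral over the window. [K] depends on none
    of [k], [x], [P], so the bounds can be added over many windows. *)
Lemma window_bounds eps : 0 < eps -> eps <= 1 / 20 -> exists Q m K,
  [/\ (0 < Q)%N, (0 < m)%N, 0 <= K &
  forall (k : nat) x P, let W := Q%:R * T1 in let h := T1 / m%:R in let z := k%:R * T1 in
  K <= z -> K <= x - (z + W) ->
  (forall u : R, 0 <= u -> is_derive u (1 : R) P (f1 u * f2 (x - u))) ->
  let I := expR (a * x) * (P (z + W) - P z) in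
  \sum_(r < Q * m) (N1 (z + r.+1%:R * h) - N1 (z + r%:R * h)) * N2 (x - (z + r%:R * h))
    <= (1 + 20 * eps) * (a * M1 * M2) * I /\
  (1 - 20 * eps) * (a * M1 * M2) * I <=
  \sum_(r < Q * m) (N1 (z + r.+1%:R * h) - N1 (z + r%:R * h)) * N2 (x - (z + r.+1%:R * h))].
Proof.
move=> e0 e3.
have B0 : 0 < B by exact: lt_le_trans (s1_gt0 0) (s1_le 0).
have e1 : eps <= 1 by lra.
have [m [m0 hE /andP[D1 D2]]] := cells e0 e1.
set h := T1 / m%:R in hE D1 D2; set E := expR (a * h) in hE D1 D2.
pose dd (r : nat) := E * s1 (r%:R * h + h) - s1 (r%:R * h).
set D := \sum_(r < m) _ in D1 D2.
have [Q Q0 wQ] := weyl (mulr_gt0 e0 M2_gt0).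
have mR : 0 < m%:R :> R by rewrite ltr0n.
have QR : 0 < Q%:R :> R by rewrite ltr0n.
have h0 : 0 < h by rewrite divr_gt0.
have mh : m%:R * h = T1 by rewrite mulrC divfK// gt_eqF.
have E1 : 1 <= E by rewrite -expR0 ler_expR mulr_ge0 ?ltW.
have D0 : 0 < D by apply: lt_le_trans D1; rewrite !mulr_gt0//; lra.
pose W := Q%:R * T1; have W0 : 0 < W by rewrite mulr_gt0.
have dd0 r : 0 <= dd r.
  have hle : r%:R * h <= r%:R * h + h by rewrite lerDl ltW.
  have := growth1 hle; rewrite addrAC subrr add0r -/E /dd; lra.
have ddp q i : dd (q * m + i)%N = dd i.
  have e y : s1 (q%:R * T1 + y) = s1 y.
    elim: q => [|q IH]; first by rewrite mul0r add0r.
    by rewrite -IH -[RHS]per1 -natr1; congr s1; ring.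
  by rewrite /dd natrD natrM mulrDl -[_ * m%:R * h]mulrA mh -[in E * _]addrA !e.
have wD := weighted_equidistribution dd0 ddp mh wQ.
(* The relative errors [3 eta] and [9 eta B] of the frozen windows must be negligible
   against the fixed numbers of cells. *)
pose eta := Num.min (eps / 3) (eps * (D * M2) / (18 * B ^+ 2 * m%:R)).
have den : 0 < 18 * B ^+ 2 * m%:R by rewrite !mulr_gt0// exprn_gt0.
have eta0 : 0 < eta by rewrite lt_min !divr_gt0// !mulr_gt0.
have /andP[eta1 eta2] : (eta <= eps / 3) && (eta <= eps * (D * M2) / (18 * B ^+ 2 * m%:R)).
  by rewrite -le_min.
rewrite ler_pdivlMr// in eta2.
have eta01 : 0 < eta <= 1 by rewrite eta0/=; lra.
have [K1 K1P] := asymptotic_frozen f1_gt0 s1_gt0 sl1 as1 W eta01.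
have [K2 K2P] := asymptotic_frozen f2_gt0 s2_gt0 sl2 as2 W eta01.
have [K3 K3P] := sl1 W eta0; have [K4 K4P] := sl2 W eta0.
exists Q, m, (Num.max 0 (Num.max (Num.max K1 K2) (Num.max K3 K4))); split=> //.
  by rewrite le_max lexx.
move=> k x P W' h' z; rewrite -/W in W' *; rewrite /W' /h' {W' h'} -/h.
rewrite !ge_max => /and3P[z0 /andP[z1 z2] /andP[z3 z4]] /and3P[x0 /andP[x1 x2] /andP[x3 x4]] dP.
set I := expR (a * x) * _.
have cellW r : (r <= Q * m)%N -> 0 <= r%:R * h <= W.
  move=> rQ; rewrite mulr_ge0 ?(ltW h0)//=.
  have -> : W = (Q * m)%:R * h by rewrite natrM -mulrA mh.
  by rewrite ler_pM2r// ler_nat.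
have s1z r : s1 (z + r%:R * h) = s1 (r%:R * h).
  rewrite /z; elim: (k) => [|j IH]; first by rewrite mul0r add0r.
  by rewrite -IH -[RHS]per1 -natr1; congr s1; ring.
set phi0 := f1 z * f2 (x - z).
have phi0_gt0 : 0 < phi0 by rewrite mulr_gt0.
have [fz1 fz2] := (f1_gt0 z, f2_gt0 (x - z)).
pose y1 r := N1 (z + r%:R * h) / (expR (a * (z + r%:R * h)) * f1 z).
pose y2 r := N2 (x - (z + r%:R * h)) / (expR (a * (x - (z + r%:R * h))) * f2 (x - z)).
have normalize (n c t q : R) : 0 < c -> `|n - c * t| <= q * (c * t) -> `|n / c - t| <= q * t.
  move=> c0; have -> : n / c - t = (n - c * t) / c.
    by rewrite mulrBl [c * t]mulrC mulfK// gt_eqF.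
  by rewrite normrM normfV (gtr0_norm c0) ler_pdivrMr// -mulrA (mulrC t).
have zr r : (r <= Q * m)%N -> z <= z + r%:R * h /\ z + r%:R * h <= z + W.
  by move=> /cellW /andP[? ?]; rewrite lerDl lerD2l.
have y1P r : (r <= Q * m)%N -> `|y1 r - s1 (r%:R * h)| <= 3 * eta * s1 (r%:R * h).
  move=> rQ; have [r1 r2] := zr r rQ; rewrite -(s1z r); apply: normalize.
    by rewrite mulr_gt0 ?expR_gt0.
  apply: K1P => //; first exact: le_trans r1.
  by rewrite addrAC subrr add0r ger0_norm; have /andP[] := cellW r rQ.
have y2P r : (r <= Q * m)%N ->
    `|y2 r - s2 (x - (z + r%:R * h))| <= 3 * eta * s2 (x - (z + r%:R * h)).
  move=> rQ; have [r1 r2] := zr r rQ; apply: normalize.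
    by rewrite mulr_gt0 ?expR_gt0.
  have z_le : x - (z + W) <= x - (z + r%:R * h) by rewrite lerD2l lerN2.
  have z_ge : x - (z + W) <= x - z by rewrite lerD2l lerN2 lerDl ltW.
  apply: K2P; [exact: le_trans z_le|exact: le_trans z_ge|].
  have -> : x - (z + r%:R * h) - (x - z) = - (r%:R * h) by ring.
  by rewrite normrN ger0_norm; have /andP[] := cellW r rQ.
have y2_ge0 r : 0 <= y2 r.
  by rewrite divr_ge0 ?N2_ge0// mulr_ge0 ?expR_ge0// ltW.
have r1h r : r.+1%:R * h = r%:R * h + h by rewrite -natr1 mulrDl mul1r.
pose g r := E * y1 r.+1 - y1 r.
have eN2 : 3 * eta <= eps by rewrite mulrC -ler_pdivlMr.
have gP r : (r < Q * m)%N -> `|g r - dd r| <= 9 * eta * B.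
  move=> rQ; have := y1P r (ltnW rQ); have := y1P r.+1 rQ; rewrite r1h /g /dd.
  have := s1_le (r%:R * h); have := s1_le (r%:R * h + h).
  set t' := s1 (_ + h); set t := s1 (r%:R * h) => t'B tB.
  have q1 : 3 * eta * t' <= 3 * eta * B by rewrite ler_pM2l// mulr_gt0.
  have q2 : 3 * eta * t <= 3 * eta * B by rewrite ler_pM2l// mulr_gt0.
  have E43 : E <= 2 by apply: le_trans hE _; rewrite -[2]/(1 + 1) lerD2l.
  by move=> v u; exact: (cell_error q1 q2 E1 E43 u v).
have N1E r : N1 (z + r%:R * h) = expR (a * (z + r%:R * h)) * f1 z * y1 r.
  by rewrite /y1 [RHS]mulrC divfK// gt_eqF// mulr_gt0 ?expR_gt0.
have N2E r : N2 (x - (z + r%:R * h)) = expR (a * (x - (z + r%:R * h))) * f2 (x - z) * y2 r.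
  by rewrite /y2 [RHS]mulrC divfK// gt_eqF// mulr_gt0 ?expR_gt0.
have expE r : expR (a * (z + r.+1%:R * h)) = expR (a * (z + r%:R * h)) * E.
  by rewrite r1h /E -expRD; congr (expR _); ring.
have expx w : expR (a * w) * expR (a * (x - w)) = expR (a * x).
  by rewrite -expRD; congr (expR _); ring.
pose X := expR (a * x) * phi0.
have X0 : 0 < X by rewrite mulr_gt0 ?expR_gt0.
have D'0 : 0 < D * Q%:R * M2 by rewrite !mulr_gt0.
have sumU : \sum_(r < Q * m) (N1 (z + r.+1%:R * h) - N1 (z + r%:R * h)) * N2 (x - (z + r%:R * h)) =
    X * \sum_(r < Q * m) g r * y2 r.
  rewrite mulr_sumr; apply: eq_bigr => r _.
  by rewrite !N1E N2E expE /X -(expx (z + r%:R * h)) /phi0 /g; ring.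
(* With [N2] taken at the far end of the cell, the two exponentials multiply to [expR (a * x)] only
   up to the factor [E^-1]. *)
have sumL : \sum_(r < Q * m) (N1 (z + r.+1%:R * h) - N1 (z + r%:R * h)) * N2 (x - (z + r.+1%:R * h)) =
    X * (E^-1 * \sum_(r < Q * m) g r * y2 r.+1).
  rewrite !mulr_sumr; apply: eq_bigr => r _.
  rewrite !N1E N2E /X -(expx (z + r.+1%:R * h)) expE /phi0 /g; field.
  by rewrite gt_eqF// (lt_le_trans ltr01).
have constB : (Q * m)%:R * (18 * eta * B ^+ 2) <= eps * (D * Q%:R * M2).
  have -> : (Q * m)%:R * (18 * eta * B ^+ 2) = Q%:R * (eta * (18 * B ^+ 2 * m%:R)) by rewrite natrM; ring.
  have -> : eps * (D * Q%:R * M2) = Q%:R * (eps * (D * M2)) by ring.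
  by rewrite ler_pM2l.
pose V := a * M1 * M2 * W.
have V0 : 0 < V by rewrite !mulr_gt0.
have VE c : c * V = c * (a * T1 * M1) * Q%:R * M2 by rewrite /V /W; ring.
have DVle : D * Q%:R * M2 <= (1 + eps) * V by rewrite VE !ler_pM2r.
have DVge : (1 - eps) * V <= D * Q%:R * M2 by rewrite VE !ler_pM2r.
have upper : \sum_(r < Q * m) g r * y2 r <= (1 + 20 * eps) * ((1 - eps) * V).
  apply: (@window_upper_constants _ (\sum_(r < Q * m) dd r * s2 (x - z - r%:R * h))
    ((Q * m)%:R * (9 * eta * B ^+ 2)) (D * Q%:R * M2)) => //; last 2 first.
  - by have /andP[] := wD (x - z).
  - by apply: le_trans constB; rewrite mulrCA ler_wpM2l// !mulrA -natrM.
  rewrite [(Q * m)%:R * _]mulrC mulr_natr -[in X in _ *+ X](card_ord (Q * m)) -sumr_const -big_split/= mulr_sumr.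
  apply: ler_sum => r _; apply: cell_upper => //; first exact: gP.
  by have := y2P r (ltnW (ltn_ord r)); rewrite opprD addrA.
have lower : (1 - 20 * eps) * ((1 + eps) * V) <= E^-1 * \sum_(r < Q * m) g r * y2 r.+1.
  apply: (@window_lower_constants _ (\sum_(r < Q * m) dd r * s2 (x - z - h - r%:R * h))
    ((Q * m)%:R * (18 * eta * B ^+ 2)) (D * Q%:R * M2)) => //; last first.
    by have /andP[] := wD (x - z - h).
  rewrite [(Q * m)%:R * _]mulrC mulr_natr -[in X in _ *+ X](card_ord (Q * m)) -sumr_const mulr_sumr -sumrB.
  apply: ler_sum => r _; apply: cell_lower => //; first exact: gP.
  by have := y2P r.+1 (ltn_ord r); rewrite r1h opprD addrA opprD [- _ - h]addrC addrA.
have zW : z <= z + W by rewrite lerDl ltW.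
have dP' (u : R) : z <= u <= z + W -> is_derive u (1 : R) P (f1 u * f2 (x - u)).
  by move=> /andP[zu _]; apply: dP; exact: le_trans zu.
have ratio u : z <= u <= z + W -> f1 u * f2 (x - u) <= (1 + eps) * phi0 /\
    (1 - eps) * phi0 <= f1 u * f2 (x - u).
  move=> /andP[zu uW]; have xz : x - (z + W) <= x - z by rewrite lerD2l lerN2.
  have xu : x - (z + W) <= x - u by rewrite lerD2l lerN2.
  have uz : `|u - z| <= W by rewrite ger0_norm ?subr_ge0// lerBlDl.
  have uz' : `|x - u - (x - z)| <= W.
    have -> : x - u - (x - z) = - (u - z) by ring.
    by rewrite normrN.
  have [k3 k3'] := (le_trans z3 zu, le_trans x4 xu); have k4 := le_trans x4 xz.
  apply: (@ratio_bounds _ _ _ _ eta) => //.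
  - exact: K3P.
  - by apply: K3P; rewrite // distrC.
  - exact: K4P.
  - by apply: K4P; rewrite // distrC.
have IE c : X * (c * V) = (a * M1 * M2) * (expR (a * x) * (c * phi0 * (z + W - z))).
  by rewrite addrAC subrr add0r /X /V; ring.
have C0 : 0 < a * M1 * M2 by rewrite !mulr_gt0.
have I1 : (1 - eps) * phi0 * (z + W - z) <= P (z + W) - P z.
  by apply: (derive_ge_cst zW dP') => u /ratio[].
have I2 : P (z + W) - P z <= (1 + eps) * phi0 * (z + W - z).
  by apply: (derive_le_cst zW dP') => u /ratio[].
rewrite sumU sumL; split.
  apply: le_trans (ler_wpM2l (ltW X0) upper) _.
  rewrite mulrCA IE -[leRHS]mulrA ler_wpM2l//; first by rewrite addr_ge0// mulr_ge0// ltW.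
  by rewrite ler_pM2l// /I ler_pM2l ?expR_gt0.
apply: le_trans (_ : _ <= X * ((1 - 20 * eps) * ((1 + eps) * V))) _; last by rewrite ler_pM2l.
rewrite [leRHS]mulrCA IE -[leLHS]mulrA ler_wpM2l//; last by rewrite ler_pM2l// /I ler_pM2l ?expR_gt0.
by rewrite subr_ge0 mulrC -ler_pdivlMr.
Qed.

End Window.

(** * Edges of the convolution *)

Section Edges.
Context (R : realType).

Lemma is_derive_scale (c : R) (P : R -> R) (u p : R) :
  is_derive u (1 : R) P p -> is_derive u (1 : R) (fun y => c * P y) (c * p).
Proof. by move=> dP; exact: is_deriveZ. Qed.

Variables (f g Pf : R -> R).
Hypotheses (f_gt0 : forall x, 0 < f x) (g_gt0 : forall x, 0 < g x) (slg : slow g).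
Hypothesis dPf : forall u : R, 0 <= u -> is_derive u (1 : R) Pf (f u).
Hypothesis Pf_unbounded : forall L, exists2 u, 0 <= u & L <= Pf u - Pf 0.

(** The restriction to [[0, x]] makes the notion stable under the reflection [u |-> x - u], which
    exchanges [f] and [g]. *)
Definition convolution_primitive x P :=
  forall u : R, 0 <= u <= x -> is_derive u (1 : R) P (f u * g (x - u)).

Lemma convolution_primitive_mono x P u v : convolution_primitive x P ->
  0 <= u -> u <= v -> v <= x -> P u <= P v.
Proof.
move=> dP u0 uv vx; rewrite -subr_ge0 -[leLHS](mul0r (v - u)).
apply: (@derive_ge_cst _ P (fun w => f w * g (x - w))) => // w /andP[uw wv].
  by apply: dP; rewrite (le_trans u0 uw) (le_trans wv vx).
by rewrite mulr_ge0// ltW.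
Qed.

(* The divergence of the integral of [f] makes the endpoint value of [g] negligible. *)
Lemma endpoint_negligible kappa : 0 < kappa -> exists2 X, 0 <= X & forall x P, X <= x ->
  convolution_primitive x P -> g x <= kappa * (P x - P 0).
Proof.
(* On [[0, u0]] slow variation gives [g x / 2 <= g (x - u)]; an increment [2 / kappa] of [Pf] then
   yields [g x / kappa]. *)
move=> k0; have [u0 u00 hu] := Pf_unbounded (2 / kappa).
have [K KP] := slg u0 (ltr01 : 0 < 1 :> R).
exists (`|K| + u0); first by rewrite addr_ge0.
move=> x P xK dP; have gx := g_gt0 x.
have Kx : K <= x - u0 by rewrite lerBrDr (le_trans _ xK)// lerD2r ler_norm.
have u0x : u0 <= x by rewrite (le_trans _ xK)// lerDr.
have h : g x / 2 * Pf u0 - g x / 2 * Pf 0 <= P u0 - P 0.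
  apply: (@derive_le _ (fun u => g x / 2 * Pf u) P (fun u => g x / 2 * f u) (fun u => f u * g (x - u))).
  - exact: u00.
  - by move=> u /andP[u1 _]; apply: is_derive_scale; exact: dPf.
  - by move=> u /andP[u1 u2]; apply: dP; rewrite u1 (le_trans u2).
  move=> u /andP[u1 u2]; rewrite mulrC ler_pM2l// ler_pdivrMr// mulrC.
  have xu : x - u0 <= x - u by rewrite lerD2l lerN2.
  have Kx' : K <= x by apply: le_trans Kx _; rewrite lerBlDr lerDl.
  apply: KP => //; first exact: le_trans xu.
  by rewrite opprB addrC subrK ger0_norm.
have h2 : P u0 <= P x by apply: (convolution_primitive_mono dP).
have h3 : g x / 2 * (2 / kappa) <= g x / 2 * (Pf u0 - Pf 0) by rewrite ler_pM2l// divr_gt0.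
have e : g x / 2 * (2 / kappa) = g x / kappa by field; rewrite gt_eqF.
rewrite -ler_pdivrMl// mulrC; rewrite e mulrBr in h3; lra.
Qed.

(** On [[0, K0]] one has [g (x - u) <= 2 * g x] for large [x], so the segment contributes at most a
    constant times [g x], which [endpoint_negligible] controls. *)
Lemma initial_segment_negligible kappa K0 : 0 < kappa -> 0 <= K0 ->
  exists2 X, K0 <= X & forall x P, X <= x ->
  convolution_primitive x P -> P K0 - P 0 <= kappa * (P x - P 0).
Proof.
move=> k0 K00; pose c := 2 * (Pf K0 - Pf 0).
have c0 : 0 <= c.
  rewrite mulr_ge0// -[leLHS](mul0r (K0 - 0)).
  by apply: (@derive_ge_cst _ Pf f) => // u /andP[? _]; [exact: dPf|exact: ltW].
have c1 : 0 < c + 1 by rewrite ltr_wpDl.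
have [X X0 XP] := endpoint_negligible (divr_gt0 k0 c1).
have [K KP] := slg K0 (ltr01 : 0 < 1 :> R).
exists (X + `|K| + K0); first by rewrite lerDr addr_ge0.
move=> x P xK dP; have gx := g_gt0 x.
have Kx : K <= x - K0.
  by rewrite lerBrDr (le_trans _ xK)// lerD2r (le_trans (ler_norm K))// lerDr.
have K0x : K0 <= x by rewrite (le_trans _ xK)// lerDr addr_ge0.
have Xx : X <= x by rewrite (le_trans _ xK)// -addrA lerDl addr_ge0.
have h : P K0 - P 0 <= 2 * g x * Pf K0 - 2 * g x * Pf 0.
  apply: (@derive_le _ P (fun u => 2 * g x * Pf u) (fun u => f u * g (x - u)) (fun u => 2 * g x * f u)).
  - exact: K00.
  - by move=> u /andP[u1 u2]; apply: dP; rewrite u1 (le_trans u2).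
  - by move=> u /andP[u1 _]; apply: is_derive_scale; exact: dPf.
  move=> u /andP[u1 u2]; rewrite mulrC ler_pM2r//.
  have xu : x - K0 <= x - u by rewrite lerD2l lerN2.
  have Kx' : K <= x by apply: le_trans Kx _; rewrite lerBlDr lerDl.
  apply: KP => //; first exact: le_trans xu.
  by rewrite addrC addrA [- x + x]addrC subrr add0r normrN ger0_norm.
have e : 2 * g x * Pf K0 - 2 * g x * Pf 0 = c * g x by rewrite /c; ring.
rewrite e in h; apply: le_trans h _.
have Q0 : 0 <= P x - P 0 by rewrite subr_ge0 (convolution_primitive_mono dP)// (le_trans K00).
apply: le_trans (ler_wpM2l c0 (XP x P Xx dP)) _.
rewrite mulrA ler_wpM2r// mulrA ler_pdivrMr//.
by rewrite mulrC ler_pM2l// lerDl.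
Qed.

End Edges.

(** Reflection turns estimates near 0 into estimates near [x]. *)
Lemma convolution_primitive_swap (R : realType) (f g P : R -> R) x :
  convolution_primitive f g x P -> convolution_primitive g f x (fun u => - P (x - u)).
Proof.
move=> dP u /andP[u0 ux].
have dPx : is_derive (x - u) (1 : R) P (f (x - u) * g (x - (x - u))).
  by apply: dP; rewrite subr_ge0 ux lerBlDr lerDl.
have e : g u * f (x - u) = - (f (x - u) * g (x - (x - u)) * -1).
  by rewrite (_ : x - (x - u) = u); ring.
rewrite e; apply: is_deriveN; apply: (@is_derive1_comp _ P (fun u => x - u)).
by apply: is_derive_eq; rewrite add0r mul1r.
Qed.

Lemma count_upper (R : realType) (a B : R) (N f s : R -> R) :
  (forall x, 0 < f x) -> (forall x, 0 < s x) -> (forall x, s x <= B) -> slow f -> asymptotic a N f s ->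
  forall W, exists K, forall u v, K <= u -> K <= v -> `|u - v| <= W ->
    N u <= 4 * B * expR (a * u) * f v.
Proof.
move=> f0 s0 sB sl asy W.
have [|K KP] := asymptotic_frozen f0 s0 sl asy W (_ : 0 < 1 <= 1); first by rewrite ltr01 lexx.
exists K => u v Ku Kv uv; have := KP u v Ku Kv uv; rewrite ler_distl => /andP[_] /le_trans; apply.
have E0 : 0 < expR (a * u) * f v by rewrite mulr_gt0 ?expR_gt0.
have := ler_wpM2l (ltW E0) (sB u).
have -> : 4 * B * expR (a * u) * f v = 4 * (expR (a * u) * f v * B) by ring.
lra.
Qed.

(** * From windows to the full count *)

Section Assembly.
Context (R : realType).

Lemma edge_count_le (n v c E g kappa d : R) : 0 <= n -> 0 <= c -> 0 <= E -> 0 <= d -> 0 < kappa ->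
  v <= c * E * g -> g <= kappa / (n * c + 1) * d -> n * v <= kappa * (E * d).
Proof.
move=> n0 c0 E0 d0 k0 h1 h2.
have nc : 0 < n * c + 1 by rewrite ltr_wpDl// mulr_ge0.
apply: le_trans (ler_wpM2l n0 h1) _.
have -> : n * (c * E * g) = (n * c * E) * g by ring.
have ncE : 0 <= n * c * E by rewrite !mulr_ge0.
apply: le_trans (ler_wpM2l ncE h2) _.
have -> : n * c * E * (kappa / (n * c + 1) * d) = (n * c / (n * c + 1)) * (kappa * (E * d)) by ring.
apply: ler_piMl; first by rewrite !mulr_ge0// ltW.
by rewrite ler_pdivrMr// mul1r lerDl.
Qed.

Lemma shift_ge (K b x : R) : `|K| + `|b| <= x -> K <= x /\ K <= x + b.
Proof.
move=> Kx; have := ler_norm K; have := ler_norm (- b); rewrite normrN.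
by have := normr_ge0 b; split; lra.
Qed.

Lemma last_window_bounds (z0 w x W : R) : w <= x - 2 * z0 -> x - 2 * z0 < w + W ->
  z0 + w <= x - z0 /\ x - (z0 + w) <= z0 + W.
Proof. by split; lra. Qed.

Lemma middle_segment (p0 pz pJ pe px w : R) :
  pz - p0 <= w -> px - pe <= w -> pe <= pJ -> px - p0 - w - w <= pJ - pz.
Proof. by lra. Qed.

(** Error budget: the windows cost [20 * eps <= eps' / 3]; the two edge counts, and likewise the two
    omitted pieces of the integral, cost [eps' / 6] each. *)
Lemma assembly_constants (N L U e1 e2 I D C eps eps' : R) : 0 < C -> 0 <= D -> 0 < eps' ->
  0 < eps -> eps <= 1 / 20 -> 60 * eps <= eps' ->
  N <= e1 + e2 + U -> L <= N ->
  e1 <= C * eps' / 6 * D -> e2 <= C * eps' / 6 * D ->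
  U <= (1 + 20 * eps) * C * I -> (1 - 20 * eps) * C * I <= L ->
  I <= D -> D - eps' / 6 * D - eps' / 6 * D <= I ->
  `|N - C * D| <= eps' * (C * D).
Proof.
move=> C0 D0 e'0 e0 e20 ee hU hL h1 h2 h3 h4 h5 h6.
have CD : 0 <= C * D by rewrite mulr_ge0// ltW.
have c1 : 0 <= (1 + 20 * eps) * C by rewrite mulr_ge0//; lra.
have c2 : 0 <= (1 - 20 * eps) * C by rewrite mulr_ge0//; lra.
have u1 := ler_wpM2l c1 h5; have l1 := ler_wpM2l c2 h6.
have g1 : 20 * eps * (C * D) <= eps' / 3 * (C * D) by rewrite ler_wpM2r//; lra.
have g2 : 0 <= eps * eps' * (C * D) by rewrite !mulr_ge0// ltW.
have r1 : (1 + 20 * eps) * C * D = C * D + 20 * eps * (C * D) by ring.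
have r2 : (1 - 20 * eps) * C * (D - eps' / 6 * D - eps' / 6 * D) =
  C * D - eps' / 3 * (C * D) - 20 * eps * (C * D) + 20 / 3 * (eps * eps' * (C * D)) by field.
have r3 : C * eps' / 6 * D = eps' / 6 * (C * D) by ring.
rewrite r1 in u1; rewrite r2 in l1; rewrite r3 in h1 h2.
have p1 : 0 <= eps' * (C * D) by rewrite mulr_ge0// ltW.
rewrite ler_distl; apply/andP; split; lra.
Qed.

Variables (a T1 B M1 M2 b : R) (f1 f2 s1 s2 N1 N2 N P1 P2 F : R -> R).
Hypotheses (a0 : 0 < a) (T10 : 0 < T1) (M1_gt0 : 0 < M1) (M2_gt0 : 0 < M2).
Hypothesis (f1_gt0 : forall x, 0 < f1 x) (f2_gt0 : forall x, 0 < f2 x).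
Hypothesis (s1_gt0 : forall x, 0 < s1 x) (s2_gt0 : forall x, 0 < s2 x).
Hypothesis (s1_le : forall x, s1 x <= B) (s2_le : forall x, s2 x <= B).
Hypothesis per1 : forall x, s1 (x + T1) = s1 x.
Hypothesis growth1 : forall u v, u <= v -> s1 u <= expR (a * (v - u)) * s1 v.
Hypothesis (sl1 : slow f1) (sl2 : slow f2).
Hypothesis (as1 : asymptotic a N1 f1 s1) (as2 : asymptotic a N2 f2 s2).
Hypothesis (N1_ge0 : forall x, 0 <= N1 x) (N2_ge0 : forall x, 0 <= N2 x).
Hypothesis cells : forall eps, 0 < eps -> eps <= 1 -> exists m, let h := T1 / m%:R in
  [/\ (0 < m)%N, expR (a * h) <= 1 + eps &
  (1 - eps) * (a * T1 * M1) <= \sum_(r < m) (expR (a * h) * s1 (r%:R * h + h) - s1 (r%:R * h))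
    <= (1 + eps) * (a * T1 * M1)].
Hypothesis weyl : forall eps, 0 < eps -> exists2 Q, (0 < Q)%N & forall y,
    `|\sum_(q < Q) s2 (y - q%:R * T1) - Q%:R * M2| <= eps * Q%:R.
Hypothesis dP1 : forall u : R, 0 <= u -> is_derive u (1 : R) P1 (f1 u).
Hypothesis dP2 : forall u : R, 0 <= u -> is_derive u (1 : R) P2 (f2 u).
Hypothesis P1_unbounded : forall L, exists2 u, 0 <= u & L <= P1 u - P1 0.
Hypothesis P2_unbounded : forall L, exists2 u, 0 <= u & L <= P2 u - P2 0.
Hypothesis F_primitive : forall x, 0 <= x -> exists P : R -> R,
  (forall u : R, 0 <= u -> is_derive u (1 : R) P (f1 u * f2 (x - u))) /\ F x = P x - P 0.
Hypothesis N_bounds : forall x z h n, 0 <= h ->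
  N x <= N1 z * N2 (x + b) + N1 (x + b) * N2 (x - (z + n%:R * h)) +
    \sum_(r < n) (N1 (z + r.+1%:R * h) - N1 (z + r%:R * h)) * N2 (x - (z + r%:R * h)) /\
  \sum_(r < n) (N1 (z + r.+1%:R * h) - N1 (z + r%:R * h)) * N2 (x - (z + r.+1%:R * h)) <= N x.

(** Windows cover [[z0, z J]], where both arguments of the convolution are beyond the thresholds.
    Each end is accounted for twice: as pairs in [e1] and [e2], and as part of the integral in
    [seg1] and [seg2]. *)
Lemma convolution_asymptotic eps' : 0 < eps' -> exists X, forall x, X <= x ->
  `|N x - a * M1 * M2 * (expR (a * x) * F x)| <= eps' * (a * M1 * M2 * (expR (a * x) * F x)).
Proof.
move=> e'0; set C := a * M1 * M2; have C0 : 0 < C by rewrite !mulr_gt0.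
have B0 : 0 < B by exact: lt_le_trans (s1_gt0 0) (s1_le 0).
pose eps := Num.min (1 / 20) (eps' / 60).
have e0 : 0 < eps by rewrite lt_min !divr_gt0.
have /andP[e20 ee] : (eps <= 1 / 20) && (eps <= eps' / 60) by rewrite -le_min.
have {}ee : 60 * eps <= eps' by rewrite mulrC -ler_pdivlMr.
have [Q [m [Kw [Q0 m0 Kw0 win]]]] := window_bounds a0 T10 M1_gt0 M2_gt0 f1_gt0 f2_gt0
  s1_gt0 s2_gt0 s1_le s2_le per1 growth1 sl1 sl2 as1 as2 N2_ge0 cells weyl e0 e20.
pose W := Q%:R * T1; pose h := T1 / m%:R.
have W0 : 0 < W by rewrite mulr_gt0// ltr0n.
have h0 : 0 <= h by rewrite divr_ge0// ltW.
have QmhW : (Q * m)%:R * h = W.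
  by rewrite /h /W natrM -mulrA [m%:R * _]mulrC divfK// pnatr_eq0 -lt0n.
have [K1 K1P] := count_upper f2_gt0 s2_gt0 s2_le sl2 as2 `|b|.
have [K2 K2P] := count_upper f1_gt0 s1_gt0 s1_le sl1 as1 `|b|.
have [K3 K3P] := count_upper f2_gt0 s2_gt0 s2_le sl2 as2 W.
(* [z0] is a multiple of [T1], as [window_bounds] demands, beyond the thresholds [Kw] and [K3]. *)
pose k0 := Num.bound ((Kw + `|K3|) / T1); pose z0 := k0%:R * T1.
have z0K : Kw + `|K3| <= z0.
  rewrite /z0 -ler_pdivrMr//; apply: ltW; apply: archi_boundP.
  by rewrite divr_ge0 ?addr_ge0// ltW.
have z0Kw : Kw <= z0 by apply: le_trans z0K; rewrite lerDl.
have z0K3 : K3 <= z0 by apply: le_trans z0K; rewrite (le_trans (ler_norm K3))// lerDr.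
have z00 : 0 <= z0 by exact: le_trans z0Kw.
(* [c] is the cost of the shift by [b]; [c2] bounds [N2] on [[z0, z0 + W]], where [x - z J]
   falls. *)
pose c := 4 * B * expR (a * b); have c0 : 0 <= c by rewrite !mulr_ge0 ?expR_ge0 ?(ltW B0).
pose c2 := 4 * B * expR (a * (z0 + W)) * f2 z0.
have c20 : 0 <= c2 by rewrite !mulr_ge0 ?expR_ge0 ?(ltW B0) ?(ltW (f2_gt0 _)).
have kC : 0 < C * eps' / 6 by rewrite divr_gt0// mulr_gt0.
have kF : 0 < eps' / 6 by rewrite divr_gt0.
have nc1 : 0 < N1 z0 * c + 1 by rewrite ltr_wpDl// mulr_ge0.
have nc2 : 0 < c2 * c + 1 by rewrite ltr_wpDl// mulr_ge0.
(* [X1] and [X2] serve the edge pairs, [X3] and [X4] the edge pieces of the integral; [X2] and [X4]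
   concern the end near [x], through the swapped convolution. *)
have [X1 X10 X1P] := endpoint_negligible f1_gt0 f2_gt0 sl2 dP1 P1_unbounded (divr_gt0 kC nc1).
have [X2 X20 X2P] := endpoint_negligible f2_gt0 f1_gt0 sl1 dP2 P2_unbounded (divr_gt0 kC nc2).
have [X3 X30 X3P] := initial_segment_negligible f1_gt0 f2_gt0 sl2 dP1 P1_unbounded kF z00.
have z0W0 : 0 <= z0 + W by rewrite addr_ge0// ltW.
have [X4 X40 X4P] := initial_segment_negligible f2_gt0 f1_gt0 sl1 dP2 P2_unbounded kF z0W0.
exists (Num.max (Num.max (Num.max X1 X2) (Num.max X3 X4))
  (Num.max (Num.max (`|K1| + `|b|) (`|K2| + `|b|)) (2 * z0))) => x.
rewrite !ge_max => /andP[/andP[/andP[x1 x2] /andP[x3 x4]] /andP[/andP[xK1 xK2] xz]].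
have x0 : 0 <= x by exact: le_trans x1.
have [P [dP ->]] := F_primitive x0.
have cP : convolution_primitive f1 f2 x P by move=> u /andP[u0 _]; exact: dP.
have cP' := convolution_primitive_swap cP.
(* [J] full windows fit between [z0] and [x - z0]; the rest, shorter than [W], goes to the edge near
   [x]. *)
pose J := Num.truncn ((x - 2 * z0) / W).
have /andP[J1 J2] : J%:R <= (x - 2 * z0) / W < J.+1%:R.
  by apply: truncn_itv; rewrite divr_ge0 ?subr_ge0// ltW.
rewrite ler_pdivlMr// in J1; rewrite ltr_pdivrMr// in J2.
have {}J2 : x - 2 * z0 < J%:R * W + W by rewrite -{2}[W]mul1r -mulrDl natr1.
pose z (j : nat) := (k0 + j * Q)%:R * T1.
have zE j : z j = z0 + j%:R * W by rewrite /z /z0 /W natrD natrM; ring.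
have zS j : z j + W = z j.+1 by rewrite !zE -natr1; ring.
have zcell j r : z0 + (j * (Q * m) + r)%:R * h = z j + r%:R * h.
  by rewrite zE -QmhW natrD natrM; ring.
have [zJx zJx'] : z J <= x - z0 /\ x - z J <= z0 + W by rewrite zE; exact: (last_window_bounds J1 J2).
have [NU NL] := N_bounds x z0 (J * (Q * m)) h0.
have nh : z0 + (J * (Q * m))%:R * h = z J by rewrite natrM -mulrA QmhW zE.
rewrite nh in NU.
have winj (j : 'I_J) : Kw <= z j /\ Kw <= x - (z j + W).
  split; first by apply: le_trans z0Kw _; rewrite zE lerDl mulr_ge0// ltW.
  apply: le_trans z0Kw _; rewrite zS lerBrDr addrC -lerBrDr; apply: le_trans zJx.
  by rewrite !zE lerD2l ler_pM2r// ler_nat.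
pose I := expR (a * x) * (P (z J) - P z0).
have tele : \sum_(j < J) expR (a * x) * (P (z j + W) - P (z j)) = I.
  rewrite -mulr_sumr /I; congr (_ * _).
  under eq_bigr do rewrite zS.
  by rewrite -(big_mkord xpredT (fun j => P (z j.+1) - P (z j))) telescope_sumr// (zE 0%N) mul0r addr0.
have U_le : \sum_(r < J * (Q * m)) (N1 (z0 + r.+1%:R * h) - N1 (z0 + r%:R * h)) *
    N2 (x - (z0 + r%:R * h)) <= (1 + 20 * eps) * C * I.
  rewrite (sum_blocks (fun r => (N1 (z0 + r.+1%:R * h) - N1 (z0 + r%:R * h)) * N2 (x - (z0 + r%:R * h)))).
  rewrite -tele mulr_sumr; apply: ler_sum => j _.
  have [w1 w2] := winj j; have [wU _] := win (k0 + j * Q)%N x P w1 w2 dP.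
  apply: le_trans wU; apply: ler_sum => r _.
  by rewrite -addnS !zcell.
have L_ge : (1 - 20 * eps) * C * I <= \sum_(r < J * (Q * m))
    (N1 (z0 + r.+1%:R * h) - N1 (z0 + r%:R * h)) * N2 (x - (z0 + r.+1%:R * h)).
  rewrite (sum_blocks (fun r => (N1 (z0 + r.+1%:R * h) - N1 (z0 + r%:R * h)) * N2 (x - (z0 + r.+1%:R * h)))).
  rewrite -tele mulr_sumr; apply: ler_sum => j _.
  have [w1 w2] := winj j; have [_ wL] := win (k0 + j * Q)%N x P w1 w2 dP.
  apply: le_trans wL _; apply: ler_sum => r _.
  by rewrite -addnS !zcell.
have D0 : 0 <= P x - P 0 by rewrite subr_ge0 (convolution_primitive_mono f1_gt0 f2_gt0 cP).
have E0 : 0 <= expR (a * x) by exact: expR_ge0.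
have xb : `|x + b - x| <= `|b| by rewrite addrAC subrr add0r.
have ce v : 4 * B * expR (a * (x + b)) * v = c * expR (a * x) * v.
  by rewrite mulrDr expRD /c; ring.
have eP : P x - P 0 = - P (x - x) - - P (x - 0) by rewrite subrr subr0 opprK addrC.
have e1 : N1 z0 * N2 (x + b) <= C * eps' / 6 * (expR (a * x) * (P x - P 0)).
  have [k1 k2] := shift_ge xK1.
  apply: (@edge_count_le _ _ c _ (f2 x)) => //; last exact: X1P.
  by rewrite -ce; exact: K1P.
have e2 : N1 (x + b) * N2 (x - z J) <= C * eps' / 6 * (expR (a * x) * (P x - P 0)).
  have zJ0 : z0 <= x - z J by rewrite lerBrDr addrC -lerBrDr.
  have N2c : N2 (x - z J) <= c2.
    apply: le_trans (K3P (x - z J) z0 (le_trans z0K3 zJ0) z0K3 _) _.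
      by rewrite ger0_norm ?subr_ge0// lerBlDl.
    by rewrite /c2 ler_pM2r// ler_pM2l ?mulr_gt0// ler_expR ler_pM2l.
  have [k1 k2] := shift_ge xK2.
  apply: (@le_trans _ _ (c2 * N1 (x + b))); first by rewrite mulrC ler_wpM2r.
  apply: (@edge_count_le _ _ c _ (f1 x)) => //; first by rewrite -ce; exact: K2P.
  by rewrite eP; exact: (X2P x _ x2 cP').
have seg1 : P z0 - P 0 <= eps' / 6 * (P x - P 0) by exact: X3P.
have seg2 : P x - P (x - (z0 + W)) <= eps' / 6 * (P x - P 0).
  rewrite eP; have -> : P x - P (x - (z0 + W)) = - P (x - (z0 + W)) - - P (x - 0).
    by rewrite subr0 opprK addrC.
  exact: (X4P x _ x4 cP').
have z0zJ : z0 <= z J by rewrite zE lerDl mulr_ge0// ltW.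
have zJ_x : z J <= x by apply: le_trans zJx _; rewrite lerBlDr lerDl.
apply: (assembly_constants C0 (mulr_ge0 E0 D0) e'0 e0 e20 ee NU NL e1 e2 U_le L_ge).
  have mono := convolution_primitive_mono f1_gt0 f2_gt0 cP.
  by rewrite ler_wpM2l// lerB//; apply: mono => //; [exact: le_trans z0zJ|exact: le_trans zJ_x].
have PzJ : P (x - (z0 + W)) <= P (z J).
  apply: (convolution_primitive_mono f1_gt0 f2_gt0 cP) => //.
    by rewrite subr_ge0 (le_trans X40).
  by rewrite lerBlDr addrC -lerBlDr.
rewrite /I [eps' / 6 * (_ * _)]mulrCA -!mulrBr ler_wpM2l//.
exact: middle_segment seg1 seg2 PzJ.
Qed.

End Assembly.

(** * From [t] near 0 to [x = ln (1 / t)] *)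

Section Translation.
Context (R : realType).

Lemma equivalent_at_right0P (u v : R -> R) : u ~_(0^'+) v <->
  forall eps, 0 < eps -> exists K, forall x, K <= x ->
    `|u (expR (- x)) - v (expR (- x))| <= eps * `|v (expR (- x))|.
Proof.
split=> [/eqaddoP uv eps e0|uv].
  have [d /= d0 dP] := uv eps e0.
  exists (1 - ln d) => x Kx; apply: dP; last exact: expR_gt0.
  rewrite /= sub0r normrN gtr0_norm ?expR_gt0// -[ltRHS]lnK// ltr_expR; lra.
apply/eqaddoP => eps e0; have [K KP] := uv eps e0.
exists (expR (- K)) => /=; first exact: expR_gt0.
move=> t /=; rewrite sub0r normrN => tK t0; rewrite gtr0_norm// in tK.
have := KP (- ln t); rewrite opprK lnK//; apply.
by rewrite lerNr -(ler_expR _ (- K)) lnK// ltW.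
Qed.

Lemma div1_expRN (x : R) : 1 / expR (- x) = expR x.
Proof. by rewrite div1r -expRN opprK. Qed.

Lemma div_powR_expRN (p x v : R) : v / expR (- x) `^ (1 / p) = expR (1 / p * x) * v.
Proof.
rewrite mulrC; congr (_ * _).
by rewrite /powR gt_eqF ?expR_gt0// expRK mulrN expRN invrK.
Qed.

Lemma asymptotic_counting (k : scalar_kind) (H : hilbertSpace R k) (A : {linear H -> H})
    (p : R) (phi s : R -> R) :
  (forall t, 0 < t -> 0 < phi t) -> (forall x, 0 < s x) ->
  (fun t => counting_function t A) ~_(0^'+)
  (fun t => phi (1 / t) * s (ln (1 / t)) / t `^ (1 / p)) ->
  asymptotic (1 / p) (fun x => counting_function (expR (- x)) A) (fun x => phi (expR x)) s.
Proof.
move=> phi0 s0 /equivalent_at_right0P h eta e0; have [K KP] := h eta e0.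
exists K => x Kx; have := KP x Kx.
rewrite /= div1_expRN expRK div_powR_expRN mulrA.
have g0 : 0 < expR (1 / p * x) * phi (expR x) * s x by rewrite !mulr_gt0 ?expR_gt0 ?phi0 ?expR_gt0.
by rewrite (gtr0_norm g0).
Qed.

(** A relative error of [1 / 2] already forbids a zero count; this is what validates the chosen
    eigenvalue sequences of the two factors. *)
Lemma asymptotic_positive (a : R) (N f s : R -> R) :
  (forall x, 0 < f x) -> (forall x, 0 < s x) -> asymptotic a (fun x => N (expR (- x))) f s ->
  forall d, 0 < d -> exists2 t : R, 0 < t < d & N t != 0.
Proof.
move=> f0 s0 asy d d0; have half : 0 < 1 / 2 :> R by [].
have [K KP] := asy _ half; pose x := Num.max K (1 - ln d).
have xK : K <= x by rewrite le_max lexx.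
have xd : 1 - ln d <= x by rewrite le_max lexx orbT.
exists (expR (- x)).
  by rewrite expR_gt0/= -[ltRHS]lnK// ltr_expR; lra.
have := KP x xK; have g0 : 0 < expR (a * x) * f x * s x by rewrite !mulr_gt0 ?expR_gt0.
by apply: contraTneq => ->; rewrite sub0r normrN gtr0_norm// -ltNge; lra.
Qed.

Lemma mean_value_primitive (T : R) (s : R -> R) : 0 < T -> continuous s ->
  exists S : R -> R, (forall u : R, 0 <= u -> is_derive u (1 : R) S (s u)) /\
    S T - S 0 = T * mean_value T s.
Proof.
move=> T0 cs; have m1 : -1 < 0 :> R by [].
have [S [dS iS]] := @primitive_exists R s (-1) 0 m1 (fun u _ => cs u).
by exists S; split=> //; rewrite iS ?ltW// /mean_value mulrA divff ?mul1r// gt_eqF.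
Qed.

End Translation.

Theorem theorem5 (R : realType) (k : scalar_kind)
    (H1 H2 : hilbertSpace R k) (HH : hilbertTensor H1 H2)
    (A1 : {linear H1 -> H1}) (A2 : {linear H2 -> H2}) (A : {linear HH -> HH})
    (p T1 T2 C : R) (phi1 phi2 s1 s2 : R -> R)
    (cA1 : compact_operator A1) (saA1 : self_adjoint A1) (nnA1 : nonnegative A1)
    (cA2 : compact_operator A2) (saA2 : self_adjoint A2) (nnA2 : nonnegative A2)
    (tensA : is_tensor_operator A1 A2 A)
    (p_gt0 : 0 < p)
    (phi1_sv : smooth_slowly_varying phi1)
    (phi2_sv : smooth_slowly_varying phi2)
    (s1_per : admissible_periodic p T1 s1)
    (s2_per : admissible_periodic p T2 s2)
    (asymA1 : (fun t => counting_function t A1) ~_(0^'+)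
              (fun t => phi1 (1 / t) * s1 (ln (1 / t)) / t `^ (1 / p)))
    (asymA2 : (fun t => counting_function t A2) ~_(0^'+)
              (fun t => phi2 (1 / t) * s2 (ln (1 / t)) / t `^ (1 / p)))
    (phi1_int : log_integral phi1 = +oo%E)
    (phi2_int : log_integral phi2 = +oo%E)
    (incommensurable : irrational (T1 / T2))
    (phi1_log : forall sigma, 1 <= sigma ->
       `| sigma * ln sigma * derive1 phi1 sigma / phi1 sigma | <= C)
    (phi2_log : forall sigma, 1 <= sigma ->
       `| sigma * ln sigma * derive1 phi2 sigma / phi2 sigma | <= C) :
  (fun t => counting_function t A) ~_(0^'+)
  (fun t => (1 / p * mean_value T1 s1 * mean_value T2 s2) *
            mellin_convolution phi1 phi2 (1 / t) / t `^ (1 / p)).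
Proof.
have a0 : 0 < 1 / p by rewrite divr_gt0.
have [[phi1_gt0 _ _] _ _ _] := phi1_sv; have [[phi2_gt0 _ _] _ _ _] := phi2_sv.
have f1_gt0 x : 0 < phi1 (expR x) by rewrite phi1_gt0// expR_gt0.
have f2_gt0 x : 0 < phi2 (expR x) by rewrite phi2_gt0// expR_gt0.
have [T10 per1 c1 [m1 [B1 [m10 s1B]]] _] := s1_per.
have [T20 per2 c2 [m2 [B2 [m20 s2B]]] _] := s2_per.
have s1_gt0 x : 0 < s1 x by have /andP[h _] := s1B x; exact: lt_le_trans h.
have s2_gt0 x : 0 < s2 x by have /andP[h _] := s2B x; exact: lt_le_trans h.
pose B := Num.max B1 B2.
have s1_le x : s1 x <= B by have /andP[_ h] := s1B x; rewrite le_max h.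
have s2_le x : s2 x <= B by have /andP[_ h] := s2B x; rewrite le_max h orbT.
have g1 := admissible_growth p_gt0 s1_per; have g2 := admissible_growth p_gt0 s2_per.
have [S1 [dS1 S1M]] := mean_value_primitive T10 c1.
have [S2 [dS2 S2M]] := mean_value_primitive T20 c2.
have as1 := asymptotic_counting phi1_gt0 s1_gt0 asymA1.
have as2 := asymptotic_counting phi2_gt0 s2_gt0 asymA2.
have pos1 := @asymptotic_positive R _ (fun t => counting_function t A1) _ _ f1_gt0 s1_gt0 as1.
have pos2 := @asymptotic_positive R _ (fun t => counting_function t A2) _ _ f2_gt0 s2_gt0 as2.
have [b Nb] := counting_function_tensor_bounds cA1 saA1 nnA1 cA2 saA2 nnA2 tensA pos1 pos2.
have [P1 [dP1 P1u]] := smooth_sv_primitive phi1_sv phi1_int.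
have [P2 [dP2 P2u]] := smooth_sv_primitive phi2_sv phi2_int.
have M1_gt0 := mean_gt0 a0 T10 s1_gt0 g1 dS1 S1M.
have M2_gt0 := mean_gt0 a0 T20 s2_gt0 g2 dS2 S2M.
apply/equivalent_at_right0P => eps e0.
(* The roles are asymmetric: [s1] supplies the cells and weights, while [s2], of period [T2], is
   sampled with step [T1], so that irrationality of [T1 / T2] gives equidistribution. *)
have [X XP] := convolution_asymptotic a0 T10 M1_gt0 M2_gt0 f1_gt0 f2_gt0 s1_gt0 s2_gt0 s1_le s2_le
  per1 g1 (smooth_sv_slow phi1_sv) (smooth_sv_slow phi2_sv) as1 as2
  (fun x => ler0n _ _) (fun x => ler0n _ _)
  (cell_bounds a0 T10 per1 s1_gt0 s1_le g1 dS1 S1M)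
  (fun e e0 => weyl_equidistribution a0 T20 per2 s2_gt0 s2_le g2 dS2 S2M incommensurable e0)
  dP1 dP2 P1u P2u (mellin_primitive phi1_sv phi2_sv) Nb e0.
exists X => x xX; have := XP x xX.
rewrite /= div1_expRN div_powR_expRN mulrCA.
by move=> h; apply: le_trans h _; rewrite ler_pM2l// ler_norm.
Qed.
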